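(* Consider the stochastic online linear optimization problem with compact action set $\mathcal{U}\subset\mathbb{R}^d$ of dimension $d$ described in the context. Assume that the cost for each action is light-tailed. Let $T_k$ be the length of the $k$-th epoch of the epoch-based policy described in the context, and construct an exploration sequence in this epoch as follows. Let $a,\zeta,u_0$ be the constants such that the deviation bound stated in the context holds for each cost. Choose a constant $b>2/a$, a constant $c=(\log T_k)^{1/3}/T_k^{1/3}$, and a constant $w\ge\max\{b/(d\zeta u_0)^2,\ 4b/c^2\}$. For each $t>1$, if $|\mathcal{A}(t-1)|<d\lceil d^2w\log t\rceil$, then include $t$ in $\mathcal{A}(t)$. The resulting policy $\pi^g$ has regret $$R^{\pi^g}(T)=O\big(d^3\,T^{2/3}\log^{1/3}T\big).$$
   Context: Problem. $\mathcal{U}\subset\mathbb{R}^d$ is a compact set with dimension $d$, called the action set. At each time $t$ one chooses a point $x\in\mathcal{U}$ and observes the cost $\vec C_t\cdot x$, where $\vec C_t\in\mathbb{R}^d$ is drawn from an unknown distribution; the vectors $\{\vec C_t\}_{t\ge1}$ are i.i.d. over $t$. With $x^*=\arg\min_{x\in\mathcal{U}}\mathbb{E}[\vec C_t\cdot x]$ the optimal action and $x_t(\pi)$ the action chosen at time $t$ under a sequential action selection policy $\pi$, the regret is $R^{\pi}(T)=\mathbb{E}\big[\sum_{t=1}^T(\vec C_t\cdot x_t(\pi)-\vec C_t\cdot x^* )\big]$. Light-tailed costs. A random variable $X$ is light-tailed if there is $u_0>0$ with $\mathbb{E}[\exp(uX)]<\infty$ for all $|u|\le u_0$. Deviation bound: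 for i.i.d. light-tailed random variables with mean $\theta$ and sample mean $\overline X_s$ of $s$ of them, $\Pr(|\overline X_s-\theta|\ge\delta)\le 2\exp(-a\delta^2 s)$ for all $\delta\in[0,\zeta u_0]$, with $a\in(0,1/(2\zeta)]$. The constants $a,\zeta,u_0$ are such that this holds for the cost of each action. Barycentric spanner. A set $B=\{x_1,\dots,x_d\}\subset\mathcal{U}$ such that every $x\in\mathcal{U}$ is a linear combination of elements of $B$ with coefficients in $[-1,1]$. A compact subset of $\mathbb{R}^d$ always has one. Policy. The policy runs under an epoch structure: each epoch simulates one round of the algorithm below, and the epoch lengths form a geometric progression. Within an epoch, $t$ denotes time in that epoch, $\mathcal{A}(t)$ denotes the set of time indices belonging to the exploration sequence up to and including time $t$, $\mathcal{A}(1)=\{1\}$, and $|\mathcal{A}(t)|$ is its cardinality; times not included in the exploration sequence form the exploitation sequence. For positive integers $j,l$ let $j\oslash l=((j-1)\bmod l)+1$. Let $\overline\theta_{x_i}(t)$ be the sample mean of the past cost observations on the spanner element $x_i$. Algorithm at time $t$: if $t\in\mathcal{A}(t)$, choose $x_n$ with $n=|\mathcal{A}(t)|\oslash d$; if $t\notin\mathcal{A}(t)$, then for each $x\in\mathcal{U}$ write $x=\sum_{i=1}^d a_ix_i$ with $|a_i|\le1$ (coefficients unrelated to the constant $a$), set $\overline\theta_x(t)=\sum_{i=1}^d a_i\overline\theta_{x_i}(t)$, and choose an action minimizing $\overline\theta_x(t)$ over $x\in\mathcal{U}$.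
   Formalization: In each epoch w is also required to be at most a constant multiple of max{b/(dζu_0)^2, 4b/c^2}, since an unbounded w (e.g. w = T_k) makes every step exploration and the regret linear; epoch lengths are at least 2, since T_k = 1 gives c = 0 and an undefined 4b/c^2. *)

(* Defs.v *)
From HB Require Import structures.
From mathcomp Require Import all_boot all_order all_algebra.
From mathcomp Require Import all_classical all_reals all_analysis.

Set Implicit Arguments.
Unset Strict Implicit.
Unset Printing Implicit Defensive.

Import Order.TTheory GRing.Theory Num.Theory.
Import numFieldNormedType.Exports.

Local Open Scope classical_set_scope.
Local Open Scope ring_scope.

(** * Cost vectors *)

Definition mutually_independent (R : realType) (disp disp' : measure_display)
    (Omega : measurableType disp) (S : measurableType disp')
    (P : probability Omega R) (X : nat -> Omega -> S) : Prop :=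
  forall (J : seq nat) (B : nat -> set S),
    uniq J -> (forall t, measurable (B t)) ->
    P (\bigcap_(t in [set` J]) (X t @^-1` B t)) =
    (\prod_(t <- J) P (X t @^-1` B t))%E.

Definition identically_distributed (R : realType)
    (disp disp' : measure_display) (Omega : measurableType disp)
    (S : measurableType disp') (P : probability Omega R)
    (X : nat -> Omega -> S) : Prop :=
  forall (s t : nat) (B : set S),
    measurable B -> P (X s @^-1` B) = P (X t @^-1` B).

Definition iid (R : realType) (disp disp' : measure_display)
    (Omega : measurableType disp) (S : measurableType disp')
    (P : probability Omega R) (X : nat -> Omega -> S) : Prop :=
  mutually_independent P X /\ identically_distributed P X.

(** Actions are row vectors, which carry the topology and the vector space
    structure of R^d; cost vectors are tuples, which carry its Borel
    sigma-algebra. *)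
Definition dot (R : realType) (d : nat) (c : d.-tuple R) (x : 'rV[R]_d) : R :=
  \sum_(i < d) tnth c i * x 0 i.

Definition light_tailed (R : realType) (disp : measure_display)
    (Omega : measurableType disp) (P : probability Omega R)
    (u0 : R) (X : Omega -> R) : Prop :=
  forall u : R, `|u| <= u0 -> ('E_P[fun o => expR (u * X o)] < +oo)%E.

(** [X] is indexed from 0 here. *)
Definition deviation_bound (R : realType) (disp : measure_display)
    (Omega : measurableType disp) (P : probability Omega R)
    (a zeta u0 : R) (X : nat -> Omega -> R) : Prop :=
  forall (s : nat) (delta : R), (0 < s)%N -> 0 <= delta <= zeta * u0 ->
    (P [set o | (delta <=
          `| s%:R^-1 * (\sum_(j < s) X j o) - fine 'E_P[X 0%N] |)%R]
     <= (2 * expR (- a * delta ^+ 2 * s%:R))%:E)%E.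

(** * Action set and barycentric spanner *)

(** The linear span of [U] has dimension [d]. *)
Definition full_dimensional (R : realType) (d : nat) (U : set 'rV[R]_d) :
    Prop :=
  exists2 X : seq 'rV[R]_d, [set` X] `<=` U & \dim <<X>>%VS = d.

Definition bary_coordinates (R : realType) (d : nat) (B : 'I_d -> 'rV[R]_d)
    (x : 'rV[R]_d) (coef : 'I_d -> R) : Prop :=
  x = \sum_(i < d) coef i *: B i /\ forall i, `|coef i| <= 1.

Definition barycentric_spanner (R : realType) (d : nat) (U : set 'rV[R]_d)
    (B : 'I_d -> 'rV[R]_d) : Prop :=
  (forall i, U (B i)) /\
  (forall x, U x -> exists coef, bary_coordinates B x coef).

(** * Policies and regret *)

(** A sequential policy maps the costs observed at times 1, ..., t - 1, in
    that order, to the action chosen at time t. *)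
Definition policy (R : realType) (d : nat) := seq R -> 'rV[R]_d.

Definition measurable_policy (R : realType) (d : nat) (pi : policy R d) :
    Prop :=
  forall (n : nat) (i : 'I_d),
    measurable_fun [set: n.-tuple R] (fun h : n.-tuple R => pi h 0 i).

(** Costs observed at times 1, ..., n; [C t] is the cost vector at time t, for
    t >= 1 ([C 0] is never used). *)
Fixpoint history (R : realType) (Omega : Type) (d : nat) (pi : policy R d)
    (C : nat -> Omega -> d.-tuple R) (n : nat) (o : Omega) : seq R :=
  if n is m.+1 then
    let h := history pi C m o in rcons h (dot (C m.+1 o) (pi h))
  else [::].

Definition action (R : realType) (Omega : Type) (d : nat) (pi : policy R d)
    (C : nat -> Omega -> d.-tuple R) (t : nat) (o : Omega) : 'rV[R]_d :=
  pi (history pi C t.-1 o).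

Definition mean_cost (R : realType) (disp : measure_display)
    (Omega : measurableType disp) (P : probability Omega R) (d : nat)
    (C : nat -> Omega -> d.-tuple R) (x : 'rV[R]_d) : R :=
  fine ('E_P[fun o => dot (C 1%N o) x]).

Definition optimal_action (R : realType) (disp : measure_display)
    (Omega : measurableType disp) (P : probability Omega R) (d : nat)
    (C : nat -> Omega -> d.-tuple R) (U : set 'rV[R]_d) (xstar : 'rV[R]_d) :
    Prop :=
  U xstar /\ forall x, U x -> mean_cost P C xstar <= mean_cost P C x.

Definition regret (R : realType) (disp : measure_display)
    (Omega : measurableType disp) (P : probability Omega R) (d : nat)
    (C : nat -> Omega -> d.-tuple R) (xstar : 'rV[R]_d) (pi : policy R d)
    (T : nat) : \bar R :=
  'E_P[fun o => \sum_(1 <= t < T.+1)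
                  (dot (C t o) (action pi C t o) - dot (C t o) xstar)].

(** * The epoch-based policy *)

(** Geometric progression tau, tau q, tau q^2, ..., rounded up so that the
    lengths are integers even when [tau] or [q] is not. *)
Definition epoch_length (R : realType) (tau q : R) (k : nat) : nat :=
  `|Num.ceil (tau * q ^+ k)|%N.

Definition epoch_start (len : nat -> nat) (k : nat) : nat :=
  (\sum_(j < k) len j)%N.

Definition oslash (j l : nat) : nat := (j.-1 %% l).+1.

(** The exploration times up to and including [t], within one epoch (times in
    the epoch start at 1). *)
Fixpoint exploration (R : realType) (d : nat) (w : R) (t : nat) : seq nat :=
  if t is t'.+1 then
    let A := exploration d w t' in
    if (t' == 0%N) ||
       ((size A)%:Z < d%:Z * Num.ceil (d%:R ^+ 2 * w * ln t'.+1%:R))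
    then rcons A t'.+1 else A
  else [::].

(** Sample mean of the costs that the history [h] records for the action [x],
    ignoring the first [s0] entries (those of earlier epochs); entry [s] of [h]
    is the cost of the action [pi (take s h)]. *)
Definition sample_mean (R : realType) (d : nat) (pi : policy R d)
    (s0 : nat) (h : seq R) (x : 'rV[R]_d) : R :=
  (\sum_(s0 <= s < size h | pi (take s h) == x) h`_s) /
  (\sum_(s0 <= s < size h | pi (take s h) == x) 1)%N%:R.

Definition estimate (R : realType) (d : nat) (B : 'I_d -> 'rV[R]_d)
    (coef : 'rV[R]_d -> 'I_d -> R) (pi : policy R d)
    (s0 : nat) (h : seq R) (x : 'rV[R]_d) : R :=
  \sum_(i < d) coef x i * sample_mean pi s0 h (B i).

(** [B i] is the spanner element x_(i + 1). *)
Definition epoch_policy (R : realType) (d : nat) (U : set 'rV[R]_d)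
    (B : 'I_d -> 'rV[R]_d) (coef : 'rV[R]_d -> 'I_d -> R)
    (len : nat -> nat) (w : nat -> R) (pi : policy R d) : Prop :=
  forall (k t : nat) (h : seq R),
    (1 <= t <= len k)%N -> size h = (epoch_start len k + t.-1)%N ->
    let A := exploration d (w k) t in
    if t \in A then
      forall i : 'I_d, i.+1 = oslash (size A) d -> pi h = B i
    else
      let est := estimate B coef pi (epoch_start len k) h in
      U (pi h) /\ forall y, U y -> est (pi h) <= est y.

Definition accuracy (R : realType) (T : nat) : R :=
  ln T%:R `^ (3^-1) / T%:R `^ (3^-1).

Definition exploration_threshold (R : realType) (d : nat) (zeta u0 b : R)
    (T : nat) : R :=
  Num.max (b / (d%:R * zeta * u0) ^+ 2) (4 * b / accuracy R T ^+ 2).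

(* Main.v *)
(** Given the past, the cost vector at time t is independent of the action
    played at time t, so the regret is the sum over time of the expected gaps
    mean_cost x_t - mean_cost xstar.  In an epoch of length L there are
    O(d^3 w ln L) exploration times, each of gap at most M.  At an exploitation
    time t every spanner element has been played at least d^2 w ln t times;
    outside an event of probability at most 2 d / t all d sample means are
    within c / (2 d) of their expectations, so that, the coordinates being at
    most 1 in absolute value, the gap is at most c.

    Sample means also use the costs seen during exploitation, hence the number
    of samples is random and depends on the observations.  One bounds the
    probability of a deviation with exactly s samples by the deviation
    probability of s i.i.d. costs, and sums over s < t: this costs a
    factor t, which the condition b > 2 / a absorbs.  With
    c = (ln L / L)^(1/3) each epoch contributes O(d^3 L^(2/3) (ln L)^(1/3)), and
    the sum over epochs is dominated by the last one, of length O(T). *)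
Require Import Defs.
From HB Require Import structures.
From mathcomp Require Import all_boot all_order all_algebra.
From mathcomp Require Import all_classical all_reals all_analysis.
From mathcomp Require Import measurable_realfun ring lra.
Import Order.TTheory GRing.Theory Num.Theory.
Import numFieldNormedType.Exports.
Local Open Scope classical_set_scope.
Local Open Scope ring_scope.

Set Implicit Arguments.
Unset Strict Implicit.
Unset Printing Implicit Defensive.

(** * Independence *)

Section independence.
Local Open Scope ereal_scope.
Context {R : realType} {d d1 d2 : measure_display} {Omega : measurableType d}
  {S : measurableType d1} {T : measurableType d2} (P : probability Omega R).

Definition independent_pair (Y : Omega -> S) (Z : Omega -> T) : Prop :=
  forall A B, measurable A -> measurable B ->
    P (Y @^-1` A `&` Z @^-1` B) = P (Y @^-1` A) * P (Z @^-1` B).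

(** Rectangles are stable under intersection and generate the product sigma-algebra, so finite
    measures that agree on them coincide. The whole space is a rectangle, so finiteness carries over
    to [m2]. *)
Lemma measure_rectangle_unique (m1 m2 : {measure set (S * T) -> \bar R}) :
  m1 setT < +oo ->
  (forall A B, measurable A -> measurable B ->
    m1 (A `*` B) = m2 (A `*` B)) ->
  forall E, measurable E -> m1 E = m2 E.
Proof.
move=> m1fin m12 E mE.
pose G : set (set (S * T)) := [set A `*` B | A in measurable & B in measurable].
apply: (measure_unique G (fun=> setT)) => //.
- exact: measurable_prod_measurableType.
- move=> _ _ [A1 mA1 [B1 mB1 <-]] [A2 mA2 [B2 mB2 <-]].
  exists (A1 `&` A2); first exact: measurableI.
  by exists (B1 `&` B2); [exact: measurableI|rewrite setXI].
- by move=> _; exists setT => //; exists setT => //; rewrite setXTT.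
- by apply/seteqP; split => // x _; exists 0%N.
- by move=> _ [A mA [B mB <-]]; exact: m12.
Qed.

Lemma distribution_pair (Y : {mfun Omega >-> S}) (Z : {mfun Omega >-> T}) :
  independent_pair Y Z -> forall E, measurable E ->
  pushforward P (fun o => (Y o, Z o)) E =
  (distribution P Y \x distribution P Z) E.
Proof.
move=> YZ E mE.
have mYZ : measurable_fun setT (fun o => (Y o, Z o)).
  exact: measurable_fun_pair.
pose YZm : {mfun Omega >-> (S * T)%type} := mfun_Sub (mem_set mYZ).
rewrite (_ : pushforward _ _ = distribution P YZm)//.
apply: measure_rectangle_unique => //.
  by rewrite -[ltLHS]/(distribution P YZm setT) probability_setT ltry.
by move=> A B mA mB; rewrite /= product_measure1E// -YZ.
Qed.

(** Independence makes the joint law a product, so Tonelli allows freezing [Y] while [Z] is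
    averaged. *)
Lemma ge0_integral_independent (Y : {mfun Omega >-> S})
    (Z : {mfun Omega >-> T}) (f : S * T -> \bar R) :
  independent_pair Y Z -> measurable_fun [set: S * T] f -> (forall x, 0 <= f x) ->
  \int[P]_o f (Y o, Z o) = \int[P]_o \int[distribution P Z]_z f (Y o, z).
Proof.
move=> YZ mf f0.
have mYZ : measurable_fun setT (fun o => (Y o, Z o)).
  exact: measurable_fun_pair.
pose YZm : {mfun Omega >-> (S * T)%type} := mfun_Sub (mem_set mYZ).
rewrite -[LHS](@ge0_integral_distribution _ _ _ _ _ P YZm f mf f0).
rewrite (eq_measure_integral (distribution P Y \x distribution P Z)%E);
  last by move=> A mA _; exact: distribution_pair.
rewrite (fubini_tonelli1 f mf f0) ge0_integral_distribution//.
  exact: measurable_fun_fubini_tonelli_F.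
by move=> y; exact: integral_ge0.
Qed.

(** Fubini for the product law, the product being dominated by [|k|] times [|W (Z o)|]. The bound on
    [V] is asked only along the values of [Y]: later [V] is a coordinate of the policy, controlled
    on reachable histories alone. *)
Lemma independent_mul (Y : {mfun Omega >-> S}) (Z : {mfun Omega >-> T})
    (V : S -> R) (W : T -> R) (k : R) :
  independent_pair Y Z -> measurable_fun setT V -> measurable_fun setT W ->
  (forall y, (`|V (Y y)| <= k)%R) ->
  P.-integrable setT (EFin \o (W \o Z)) ->
  P.-integrable setT (fun o => (V (Y o) * W (Z o))%:E) /\
  'E_P[fun o => (V (Y o) * W (Z o))%R] = 'E_P[V \o Y] * 'E_P[W \o Z].
Proof.
move=> YZ mV mW Vk intW.
pose f (x : S * T) : \bar R := (V x.1 * W x.2)%:E.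
have mf : measurable_fun [set: S * T] f.
  apply/measurable_EFinP; apply: measurable_funM.
    by apply: measurableT_comp => //; exact: measurable_fst.
  by apply: measurableT_comp => //; exact: measurable_snd.
have mYZ : measurable_fun setT (fun o => (Y o, Z o)).
  exact: measurable_fun_pair.
pose YZm : {mfun Omega >-> (S * T)%type} := mfun_Sub (mem_set mYZ).
have intV : P.-integrable setT (EFin \o (V \o Y)).
  apply: (le_integrable _ _ _ (finite_measure_integrable_cst P k measurableT)) => //.
    by apply/measurable_EFinP; exact: measurableT_comp.
  move=> o _ /=; rewrite lee_fin (le_trans (Vk o))// ler_norm//.
have int1 : P.-integrable setT (f \o YZm).
  have /integrableP[mW' Woo] := intW.
  apply/integrableP; split; first exact: measurableT_comp.
  rewrite (@le_lt_trans _ _ (\int[P]_o (`|k|%:E * `|(EFin \o (W \o Z)) o|)))//.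
    apply: ge0_le_integral => //.
    - by apply: measurableT_comp => //; exact: measurableT_comp.
    - apply: emeasurable_funM => //.
      by apply: measurableT_comp => //.
    - move=> o _ /=; rewrite -EFinM lee_fin normrM ler_wpM2r//.
      by rewrite (le_trans (Vk o))// ler_norm.
  rewrite ge0_integralZl//; last first.
    by apply: measurableT_comp => //.
  by rewrite lte_mul_pinfty.
have int2 : (distribution P Y \x distribution P Z).-integrable setT f.
  apply/integrableP; split => //.
  rewrite (eq_measure_integral (distribution P YZm)); last first.
    by move=> A mA _; exact/esym/distribution_pair.
  have /integrableP[_] := int1.
  rewrite ge0_integral_distribution//.
  exact: measurableT_comp.
split; first exact: int1.
rewrite unlock.
rewrite -[LHS]/(\int[P]_o (f \o YZm) o) -integral_distribution//.
rewrite (eq_measure_integral (distribution P Y \x distribution P Z)%E);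
  last by move=> A mA _; exact: distribution_pair.
rewrite -(integral12_prod_meas1 int2).
have intWZ : (distribution P Z).-integrable setT (EFin \o W).
  apply/integrableP; split; first exact/measurable_EFinP.
  have /integrableP[_] := intW.
  rewrite ge0_integral_distribution//.
  by apply: measurableT_comp => //; exact/measurable_EFinP.
rewrite (eq_integral (fun y => (V y)%:E * \int[P]_o (W (Z o))%:E)); last first.
  move=> y _; rewrite /f /fubini_F /=.
  under eq_integral do rewrite EFinM.
  rewrite integralZl//; congr (_ * _).
  rewrite (@integral_distribution _ _ _ _ _ P Z (EFin \o W))//.
  exact/measurable_EFinP.
(* The scalar rules for integrals want a real factor, so the inner integral, finite by
   integrability, is named as a real. *)
have [r ->] : exists r : R, \int[P]_o (W (Z o))%:E = r%:E.
  by exists (fine (\int[P]_o (W (Z o))%:E)); rewrite fineK// integrable_fin_num.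
rewrite (@integral_distribution _ _ _ _ _ P Y (fun y => (V y)%:E * r%:E)).
- by rewrite -integralZr.
- by apply: emeasurable_funM => //; exact/measurable_EFinP.
- rewrite (_ : _ \o _ = (fun o => (EFin \o (V \o Y)) o * r%:E))//.
  exact: integrableZr.
Qed.

End independence.

(** * Independence of a past variable from the whole future of a sequence, and its propagation in
    time *)

Section independence_of_the_future.
Local Open Scope ereal_scope.
Context {R : realType} {d d1 d2 d3 : measure_display} {Omega : measurableType d}
  {S : measurableType d1} {T : measurableType d2} {S' : measurableType d3}
  (P : probability Omega R).

(** Quantifying over finite families of later times, and not only over [X n], is what survives the
    absorption of [X n] into [Y]. The factored right-hand side builds in the mutual independence of
    the later terms. *)
Definition independent_of_future {d'} {S0 : measurableType d'}
    (X : nat -> Omega -> T) (n : nat) (Y : Omega -> S0) : Prop :=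
  forall (J : seq nat) (B : nat -> set T) (A : set S0),
    uniq J -> (forall t, t \in J -> n <= t)%N ->
    (forall t, measurable (B t)) -> measurable A ->
    P (Y @^-1` A `&` \bigcap_(t in [set` J]) (X t @^-1` B t)) =
    P (Y @^-1` A) * \prod_(t <- J) P (X t @^-1` B t).

Lemma independent_of_future_cst (X : nat -> Omega -> T) (y : S) :
  mutually_independent P X -> independent_of_future X 0 (cst y).
Proof.
move=> iX J B A uJ _ mB mA.
rewrite preimage_cst; case: ifP => _.
  by rewrite setTI probability_setT mul1e iX.
by rewrite set0I measure0 mul0e.
Qed.

Lemma independent_of_future_next (X : nat -> Omega -> T) n (Y : Omega -> S) :
  independent_of_future X n Y -> independent_pair P Y (X n).
Proof.
move=> iY A B mA mB.
have := iY [:: n] (fun=> B) A isT _ (fun=> mB) mA.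
rewrite big_seq1 => <-; last by move=> t; rewrite inE => /eqP ->.
by congr (P (_ `&` _)); rewrite set_cons1 bigcap_set1.
Qed.

(** Two finite measures on pairs are compared: the law of [(Y, X n)] restricted to the future event
    [G], and the same law scaled by the product [c]. They agree on rectangles by the hypothesis with
    [n] added to [J], hence on the preimage of [A] under [g]. *)
Lemma independent_of_future_step (X : nat -> {mfun Omega >-> T}) n
    (Y : {mfun Omega >-> S}) (g : S * T -> S') :
  measurable_fun [set: S * T] g ->
  independent_of_future X n Y ->
  independent_of_future X n.+1 (fun o => g (Y o, X n o)).
Proof.
move=> mg iY J B A uJ Jn mB mA.
have mYX : measurable_fun setT (fun o => (Y o, X n o)).
  exact: measurable_fun_pair.
pose YX : {mfun Omega >-> (S * T)%type} := mfun_Sub (mem_set mYX).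
pose G := \bigcap_(t in [set` J]) (X t @^-1` B t).
have mG : measurable G.
  apply: fin_bigcap_measurable => // t _.
  by rewrite -[X in measurable X]setTI; exact: measurable_funPT.
set c := \prod_(t <- J) _.
have c0 : 0 <= c by rewrite /c; elim/big_ind: _ => //; exact: mule_ge0.
have cfin : c \is a fin_num.
  rewrite /c big_seq; elim/big_ind: _ => // [x y|t _]; first exact: fin_numM.
  exact: fin_num_measure (measurable_funPTI _ (mB t)).
have Jn' t : t \in n :: J -> (n <= t)%N.
  by rewrite inE => /orP[/eqP ->//|/Jn/ltnW].
have unJ : uniq (n :: J).
  by rewrite /= uJ andbT; apply/negP => /Jn; rewrite ltnn.
pose m1 : {measure set (S * T) -> \bar R} :=
  measure_function_pushforward__canonical__measure_function_Measure (mrestr P mG) mYX.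
pose m2 : {measure set (S * T) -> \bar R} :=
  mscale (NngNum (fine_ge0 c0)) (distribution P YX).
have key : forall E, measurable E -> m1 E = m2 E.
  apply: measure_rectangle_unique.
    rewrite /m1 /= /pushforward /mrestr.
    by rewrite (le_lt_trans (probability_le1 _ _))// ?ltry// preimage_setT setTI.
  move=> A' B' mA' mB'.
  rewrite /m1 /m2 /= /pushforward /mrestr /mscale/= fineK// muleC.
  (* The hypothesis takes one event per time: [B'] is put at [n], and since [n] is not in [J] the
     other entries stay those of [B]. *)
  have := iY (n :: J) (fun t => if t == n then B' else B t) A' unJ Jn' _ mA'.
  rewrite bigcap_seq !big_cons eqxx -bigcap_seq => e2.
  have e1 := independent_of_future_next iY mA' mB'.
  rewrite -[distribution _ _ _]/(P (Y @^-1` A' `&` X n @^-1` B')) e1.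
  rewrite -muleA.
  rewrite (_ : c = \prod_(t <- J) P (X t @^-1` (if t == n then B' else B t))).
    rewrite -e2; last by move=> t; case: ifP.
    congr (P _); rewrite setIA; congr (_ `&` _).
    apply: eq_bigcapr => t /= /Jn; by case: eqP => // ->; rewrite ltnn.
  rewrite /c big_seq [RHS]big_seq; apply: eq_bigr => t /Jn.
  by case: eqP => // ->; rewrite ltnn.
have mgA : measurable (g @^-1` A) by rewrite -[X in measurable X]setTI; exact: mg.
have := key _ mgA.
by rewrite /m1 /m2 /= /pushforward /mrestr /mscale/= fineK// muleC.
Qed.

End independence_of_the_future.

(** * Measurable policies *)

Section tuples.
Context {d d' : measure_display} {T' : measurableType d'} {T : measurableType d}.

Lemma measurable_nth_tuple (x0 : T) n i :
  measurable_fun [set: n.-tuple T] (fun y : n.-tuple T => nth x0 y i).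
Proof.
have [lt_in|le_ni] := ltnP i n.
  rewrite (_ : (fun _ => _) = (fun y => tnth y (Ordinal lt_in))).
    exact: measurable_tnth.
  by apply/funext => y; rewrite (tnth_nth x0).
rewrite (_ : (fun _ => _) = cst x0); first exact: measurable_cst.
by apply/funext => y; rewrite nth_default// size_tuple.
Qed.

Lemma measurable_rcons n (f : T' -> n.-tuple T) (g : T' -> T) :
  measurable_fun setT f -> measurable_fun setT g ->
  measurable_fun setT (fun x => [tuple of rcons (f x) (g x)]).
Proof.
move=> mf mg; apply/measurable_fun_tnthP => i.
have [lt_in|le_ni] := ltnP i n.
  rewrite (_ : _ \o _ = (fun y => tnth y (Ordinal lt_in)) \o f).
    by apply: measurableT_comp => //; exact: measurable_tnth.
  apply/funext => x /=.
  by rewrite !(tnth_nth (g x)) /= nth_rcons size_tuple lt_in.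
rewrite (_ : _ \o _ = g)//; apply/funext => x /=.
have -> : i = ord_max by apply/val_inj/anti_leq; rewrite -ltnS ltn_ord.
by rewrite (tnth_nth (g x)) /= nth_rcons size_tuple ltnn eqxx.
Qed.

End tuples.

Section policy_measurability.
Context {R : realType} {d : nat} (pi : policy R d).
Hypothesis mpi : measurable_policy pi.

Lemma measurable_policy_eq n (x : 'rV[R]_d) :
  measurable_fun [set: n.-tuple R] (fun y : n.-tuple R => pi y == x).
Proof.
apply: (measurable_fun_bool true); rewrite setTI.
rewrite (_ : _ @^-1` _ =
    \bigcap_(i in [set: 'I_d]) ((fun y : n.-tuple R => pi y 0 i) @^-1` [set x 0 i])).
  apply: fin_bigcap_measurable => // i _.
  by rewrite -[X in measurable X]setTI; exact: mpi.
apply/seteqP; split => y /=; first by move=> /eqP yx i _ /=; rewrite yx.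
by move=> yx; apply/eqP/rowP => i; exact: yx.
Qed.

Lemma measurable_policy_take n s (x : 'rV[R]_d) : (s <= n)%N ->
  measurable_fun [set: n.-tuple R] (fun y : n.-tuple R => pi (take s y) == x).
Proof.
(* [measurable_policy] speaks of tuples of fixed length, so the prefix is rebuilt coordinatewise as
   an [s.-tuple]. *)
move=> sn; pose f (y : n.-tuple R) := [tuple (tval y)`_i | i < s].
rewrite (_ : (fun _ => _) = (fun y : s.-tuple R => pi y == x) \o f).
  apply: measurableT_comp; first exact: measurable_policy_eq.
  apply/measurable_fun_tnthP => i.
  rewrite (_ : _ \o _ = (fun y : n.-tuple R => (tval y)`_i)).
    exact: measurable_nth_tuple.
  by apply/funext => y /=; rewrite tnth_mktuple.
apply/funext => y /=; congr (pi _ == x).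
apply: (@eq_from_nth _ 0); rewrite size_takel ?size_tuple//.
  by rewrite card_ord.
move=> i lt_is; rewrite nth_take//.
by rewrite (nth_map (Ordinal lt_is)) ?size_enum_ord// nth_enum_ord.
Qed.

(** [sample_mean] is [total] over [plays] by conversion; separating them lets each be proved
    measurable and be updated by one new cost. *)
Definition plays (s0 : nat) (x : 'rV[R]_d) (h : seq R) : nat :=
  (\sum_(s0 <= s < size h | pi (take s h) == x) 1)%N.

Definition total (s0 : nat) (x : 'rV[R]_d) (h : seq R) : R :=
  \sum_(s0 <= s < size h | pi (take s h) == x) h`_s.

Lemma plays_rcons s0 x h c : (s0 <= size h)%N ->
  plays s0 x (rcons h c) = (plays s0 x h + (pi h == x))%N.
Proof.
move=> s0h; rewrite /plays size_rcons big_mkcond big_nat_recr//= -big_mkcond/=.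
rewrite -cats1 take_size_cat//.
have -> : (if pi h == x then 1 else 0)%N = (pi h == x) :> nat by case: (_ == _).
congr (_ + _)%N.
apply: congr_big_nat => // i /andP[_ /ltnW ih].
by rewrite takel_cat.
Qed.

Lemma total_rcons s0 x h c : (s0 <= size h)%N ->
  total s0 x (rcons h c) = total s0 x h + (if pi h == x then c else 0).
Proof.
move=> s0h; rewrite /total size_rcons big_mkcond big_nat_recr//= -big_mkcond/=.
rewrite -cats1 take_size_cat// nth_cat ltnn subnn/=; congr +%R.
apply: congr_big_nat => // i /andP[_ ih]; first by rewrite takel_cat ?(ltnW ih).
by move/andP: ih => [_ ih]; rewrite nth_cat ih.
Qed.

Lemma plays0 s0 x h : (size h <= s0)%N -> plays s0 x h = 0%N.
Proof. by move=> hs0; rewrite /plays big_geq. Qed.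

Lemma total0 s0 x h : (size h <= s0)%N -> total s0 x h = 0.
Proof. by move=> hs0; rewrite /total big_geq. Qed.

Lemma measurable_plays s0 x n :
  measurable_fun [set: n.-tuple R] (fun y : n.-tuple R => (plays s0 x y)%:R : R).
Proof.
rewrite (_ : (fun _ => _) = fun y : n.-tuple R =>
    \sum_(i < n) (if (s0 <= i)%N && (pi (take i y) == x) then 1 else 0)).
  apply: measurable_sum => i.
  apply: measurable_fun_ifT => //.
  apply: measurable_and => //.
  by apply: measurable_policy_take; exact: ltnW.
apply/funext => y; rewrite /plays size_tuple natr_sum.
rewrite (big_nat_widenl s0 0)// big_mkord big_mkcond/=.
by apply: eq_bigr => i _; rewrite andbC.
Qed.

Lemma measurable_total s0 x n :
  measurable_fun [set: n.-tuple R] (fun y : n.-tuple R => total s0 x y).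
Proof.
rewrite (_ : (fun _ => _) = fun y : n.-tuple R =>
    \sum_(i < n) (if (s0 <= i)%N && (pi (take i y) == x) then (tval y)`_i else 0)).
  apply: measurable_sum => i.
  apply: measurable_fun_ifT => //; last exact: measurable_nth_tuple.
  apply: measurable_and => //.
  by apply: measurable_policy_take; exact: ltnW.
apply/funext => y; rewrite /total size_tuple.
rewrite (big_nat_widenl s0 0)// big_mkord big_mkcond/=.
by apply: eq_bigr => i _; rewrite andbC.
Qed.

End policy_measurability.

Lemma measurable_dot (R : realType) (d : nat) (x : 'rV[R]_d) :
  measurable_fun [set: d.-tuple R] (fun c : d.-tuple R => dot c x).
Proof.
apply: measurable_sum => i; apply: measurable_funM => //.
exact: measurable_tnth.
Qed.

(** * Adaptive sampling *)

Section adaptive_sampling.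
Context {R : realType} {d : nat} {disp : measure_display}
  {Omega : measurableType disp} (P : probability Omega R)
  (C : nat -> {RV P >-> d.-tuple R}).
Hypothesis C_iid : iid P (fun n : nat => C n.+1).

Let law := distribution P (C 1%N).

Lemma integral_law n (f : d.-tuple R -> \bar R) :
  (\int[distribution P (C n.+1)]_c f c = \int[law]_c f c)%E.
Proof. by apply: eq_measure_integral => A mA _; exact: C_iid.2 n 0%N A mA. Qed.

(** [history] with its length recorded in the type, as measurability requires. *)
Fixpoint hist (pi : policy R d) (n : nat) : Omega -> n.-tuple R :=
  if n is m.+1 then fun o =>
    [tuple of rcons (hist pi m o) (dot (C m.+1 o) (pi (hist pi m o)))]
  else fun=> [tuple].

Lemma histE pi n o : hist pi n o = history pi (fun t o => C t o) n o :> seq R.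
Proof. by elim: n => //= n ->. Qed.

Lemma measurable_rcons_cost pi (mpi : measurable_policy pi) n :
  measurable_fun [set: n.-tuple R * d.-tuple R]
    (fun yc : n.-tuple R * d.-tuple R =>
       [tuple of rcons yc.1 (dot yc.2 (pi yc.1))]).
Proof.
apply: measurable_rcons; first exact: measurable_fst.
apply: measurable_sum => i; apply: measurable_funM.
  exact: measurableT_comp (measurable_tnth i) measurable_snd.
exact: measurableT_comp (mpi n i) measurable_fst.
Qed.

Arguments measurable_rcons_cost [pi] mpi n.

Lemma measurable_hist pi (mpi : measurable_policy pi) n :
  measurable_fun setT (hist pi n).
Proof.
elim: n => [|n ih] /=; first exact: measurable_cst.
have mpair : measurable_fun setT (fun o => (hist pi n o, C n.+1 o)).
  exact: measurable_fun_pair.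
exact: measurableT_comp (measurable_rcons_cost mpi n) mpair.
Qed.

Arguments measurable_hist [pi] mpi n.

(** With [C t.+1] placed at index [t], a history of length [n] is built from indices below [n]. *)
Lemma hist_independent_of_future pi (mpi : measurable_policy pi) n :
  independent_of_future P (fun t o => C t.+1 o) n (hist pi n).
Proof.
elim: n => [|n ih] /=; first exact: independent_of_future_cst C_iid.1.
pose Y : {mfun Omega >-> n.-tuple R} := mfun_Sub (mem_set (measurable_hist mpi n)).
exact: (@independent_of_future_step _ _ _ _ _ _ _ _ _ _
  (fun t => C t.+1) n Y _ (measurable_rcons_cost mpi n)).
Qed.

Lemma hist_independent pi (mpi : measurable_policy pi) n :
  independent_pair P (hist pi n) (C n.+1).
Proof.
exact (independent_of_future_next (X := fun t o => C t.+1 o)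
  (@hist_independent_of_future pi mpi n)).
Qed.

Local Open Scope ereal_scope.

(** The history is independent of the next cost vector and can be frozen. The action [x] is fixed
    here; it is the one really played once the weight [a] vanishes off the event that [pi] chooses
    [x]. *)
Lemma integral_next_cost pi (mpi : measurable_policy pi) n
    (a V : n.-tuple R -> R) (G : R -> \bar R) (x : 'rV[R]_d) :
  measurable_fun setT a -> (forall y, 0 <= a y)%R ->
  measurable_fun setT V -> measurable_fun setT G -> (forall y, 0 <= G y) ->
  \int[P]_o ((a (hist pi n o))%:E *
             G (V (hist pi n o) + dot (C n.+1 o) x)%R) =
  \int[P]_o ((a (hist pi n o))%:E *
             \int[law]_c G (V (hist pi n o) + dot c x)%R).
Proof.
move=> ma a0 mV mG G0.
pose Y : {mfun Omega >-> n.-tuple R} := mfun_Sub (mem_set (measurable_hist mpi n)).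
pose f (yc : n.-tuple R * d.-tuple R) : \bar R :=
  (a yc.1)%:E * G (V yc.1 + dot yc.2 x)%R.
have mdot : measurable_fun [set: n.-tuple R * d.-tuple R]
    (fun yc => V yc.1 + dot yc.2 x)%R.
  apply: measurable_funD.
    exact: measurableT_comp mV measurable_fst.
  exact: measurableT_comp (measurable_dot x) measurable_snd.
have mf : measurable_fun [set: n.-tuple R * d.-tuple R] f.
  apply: emeasurable_funM; last exact: measurableT_comp.
  apply/measurable_EFinP.
  exact: measurableT_comp ma measurable_fst.
have f0 yc : 0 <= f yc by rewrite mule_ge0// lee_fin.
rewrite -[LHS]/(\int[P]_o f (Y o, C n.+1 o)).
rewrite ge0_integral_independent//; last exact: hist_independent.
apply: eq_integral => o _; rewrite integral_law /f /=.
rewrite ge0_integralZl//; last by rewrite lee_fin.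
by apply: measurableT_comp => //; apply: measurable_funD => //; exact: measurable_dot.
Qed.

Variables (x : 'rV[R]_d) (D : set R).
Hypothesis mD : measurable D.

(** Probability that [y] plus the sum of [m] independent costs of [x] is in [D]. *)
Fixpoint walk (m : nat) (y : R) : \bar R :=
  if m is m'.+1 then \int[law]_c walk m' (y + dot c x)%R else (\1_D y)%:E.

Lemma walk_ge0 m y : 0 <= walk m y.
Proof.
by elim: m y => [|m ih] y /=; [rewrite lee_fin|exact: integral_ge0].
Qed.

Lemma measurable_walk m : measurable_fun setT (walk m).
Proof.
elim: m => [|m ih] /=; first by apply/measurable_EFinP; exact: measurable_indic.
apply: (@measurable_fun_fubini_tonelli_F _ _ R (d.-tuple R) R law
  (fun yc => walk m (yc.1 + dot yc.2 x)%R)).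
  apply: measurableT_comp => //; apply: measurable_funD => //.
  exact: measurableT_comp (measurable_dot x) measurable_snd.
by move=> yc; exact: walk_ge0.
Qed.

Arguments measurable_walk m : clear implicits.

(** The constant policy [x] records exactly the costs of [x], so [integral_next_cost] with weight 1
    trades one integration in [walk] for one actual cost. After [s] trades only the indicator of [D]
    is left. *)
Lemma walkE s : walk s 0%R = P [set o | D (\sum_(j < s) dot (C j.+1 o) x)%R].
Proof.
pose pi : policy R d := fun=> x.
have mpi : measurable_policy pi by move=> n i; exact: measurable_cst.
have msum n : measurable_fun [set: n.-tuple R]
    (fun y : n.-tuple R => \sum_(i < n) (tval y)`_i)%R.
  by apply: measurable_sum => i; exact: measurable_nth_tuple.
have sum_hist n o :
    (\sum_(i < n) (tval (hist pi n o))`_i = \sum_(j < n) dot (C j.+1 o) x)%R.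
  elim: n => [|n ih]; first by rewrite !big_ord0.
  rewrite !big_ord_recr /= -ih; congr +%R.
    by apply: eq_bigr => i _; rewrite nth_rcons size_tuple ltn_ord.
  by rewrite nth_rcons size_tuple ltnn eqxx.
have step m k :
    \int[P]_o walk k.+1 (\sum_(j < m) dot (C j.+1 o) x)%R =
    \int[P]_o walk k (\sum_(j < m.+1) dot (C j.+1 o) x)%R.
  have := @integral_next_cost pi mpi m (cst 1%R) _ (walk k) x
    (measurable_cst _) (fun=> ler01) (msum m)
    (measurable_walk k) (walk_ge0 k).
  move=> e; transitivity (\int[P]_o ((cst 1%R (hist pi m o))%:E *
      walk k (\sum_(i < m) (tval (hist pi m o))`_i + dot (C m.+1 o) x)%R)).
    by rewrite e; apply: eq_integral => o _; rewrite mul1e sum_hist.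
  by apply: eq_integral => o _; rewrite mul1e sum_hist big_ord_recr.
have all m k :
    \int[P]_o walk k (\sum_(j < m) dot (C j.+1 o) x)%R =
    \int[P]_o walk 0 (\sum_(j < m + k) dot (C j.+1 o) x)%R.
  elim: k m => [|k ih] m; first by rewrite addn0.
  by rewrite step ih addSnnS.
have := all 0%N s; under eq_integral do rewrite big_ord0.
rewrite integral_cst//= probability_setT mule1 => ->.
have mS : measurable_fun setT (fun o => \sum_(j < 0 + s) dot (C j.+1 o) x)%R.
  by apply: measurable_sum => j; exact: measurableT_comp (measurable_dot x) _.
rewrite /= (_ : (fun _ => _) =
    fun o => (\1_((fun o => \sum_(j < 0 + s) dot (C j.+1 o) x)%R @^-1` D) o)%:E)//.
rewrite integral_indic ?setIT//.
by rewrite -[X in measurable X]setTI; exact: mS.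
Qed.

(** With N plays of [x] so far, of total cost V, the expectation of
    [walk (s - N) V] restricted to N <= s does not increase with time: it is
    unchanged when [x] is not played, and when [x] is played the recursion of
    [walk] compensates the step, except for the mass lost once N exceeds s. *)
Lemma adaptive_sampling pi (mpi : measurable_policy pi) s0 n s : (s0 <= n)%N ->
  P [set o | plays pi s0 x (hist pi n o) = s /\ D (total pi s0 x (hist pi n o))]
  <= P [set o | D (\sum_(j < s) dot (C j.+1 o) x)%R].
Proof.
move=> s0n; rewrite -walkE.
pose N n (y : n.-tuple R) := plays pi s0 x y.
pose V n (y : n.-tuple R) := total pi s0 x y.
have mV m : measurable_fun setT (V m) by exact: measurable_total.
have mN m k : measurable_fun setT (fun y => N m y == k).
  apply: (measurable_fun_bool true); rewrite setTI.
  rewrite (_ : _ @^-1` _ = (fun y => (N m y)%:R : R) @^-1` [set k%:R : R]).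
    by rewrite -[X in measurable X]setTI; exact: measurable_plays.
  apply/seteqP; split => y /= => [/eqP -> //|/eqP].
  by rewrite eqr_nat => ->.
pose I m (b : m.-tuple R -> bool) G := \int[P]_o
  (((b (hist pi m o))%:R : R)%:E * G (V m (hist pi m o))).
have mbool m (b : m.-tuple R -> bool) :
    measurable_fun setT b -> measurable_fun setT (fun y => (b y)%:R : R).
  move=> mb; rewrite (_ : (fun _ => _) = fun y => if b y then 1%R else 0%R).
    exact: measurable_fun_ifT.
  by apply/funext => y; case: (b y).
have term0 (b : bool) G (y : R) : (forall y, 0 <= G y) ->
    0 <= (b%:R : R)%:E * G y :> \bar R.
  by move=> G0; rewrite mule_ge0// lee_fin.
have mterm m (b : m.-tuple R -> bool) G :
    measurable_fun setT b -> measurable_fun setT G ->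
    measurable_fun setT
      (fun o => ((b (hist pi m o))%:R : R)%:E * G (V m (hist pi m o))).
  move=> mb mG; apply: emeasurable_funM.
    apply/measurable_EFinP.
    exact: measurableT_comp (mbool _ _ mb) (measurable_hist mpi m).
  apply: measurableT_comp => //.
  exact: measurableT_comp (mV m) (measurable_hist mpi m).
have I0 m b G : (forall y, 0 <= G y) -> 0 <= I m b G.
  by move=> G0; apply: integral_ge0 => o _; exact: term0.
have mplay m : measurable_fun setT (fun y : m.-tuple R => pi y == x).
  exact: measurable_policy_eq.
have mskip m : measurable_fun setT (fun y : m.-tuple R => pi y != x).
  apply: (measurable_fun_bool true); rewrite setTI.
  rewrite (_ : _ @^-1` _ = (fun y : m.-tuple R => pi y == x) @^-1` [set false]).
    by rewrite -[X in measurable X]setTI; exact: mplay.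
  by apply/seteqP; split => y /=; case: (_ == _).
pose At m k y := N m y == k.
pose skip m k y := (N m y == k) && (pi y != x).
pose play m k y := (N m y == k) && (pi y == x).
have m_skip m k : measurable_fun setT (skip m k).
  by apply: measurable_and; [exact: mN|exact: mskip].
have m_play m k : measurable_fun setT (play m k).
  by apply: measurable_and; [exact: mN|exact: mplay].
have EI m k G : measurable_fun setT G -> (forall y, 0 <= G y) ->
    I m (At m k) G = I m (skip m k) G + I m (play m k) G.
  move=> mG G0; rewrite /I -ge0_integralD//.
  - apply: eq_integral => o _; rewrite -ge0_muleDl ?lee_fin//; congr (_ * _).
    rewrite -EFinD /At /skip /play.
    by case: (N m _ == k); case: (pi _ == x); rewrite /= ?addr0 ?add0r.
  - by move=> o _; exact: term0.
  - exact: mterm.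
  - by move=> o _; exact: term0.
  - exact: mterm.
(* A count [k] at the next time comes from a count [k] with [x] skipped, or from a count [k - 1]
   with [x] played. In the second case averaging the new cost rebuilds one level of [walk]. *)
have step m k : (s0 <= m)%N -> (k <= s)%N ->
    I m.+1 (At m.+1 k) (walk (s - k)) =
    I m (skip m k) (walk (s - k)) +
    (if k is k'.+1 then I m (play m k') (walk (s - k')) else 0).
  move=> s0m ks.
  have hsz o : (s0 <= size (hist pi m o))%N by rewrite size_tuple.
  pose b y := if k is k'.+1 then play m k' y else false.
  have mb : measurable_fun setT b.
    rewrite /b; case: (k) => [|k']; first exact: measurable_cst.
    exact: m_play.
  transitivity (I m (skip m k) (walk (s - k)) +
    \int[P]_o (((b (hist pi m o))%:R : R)%:E *
      walk (s - k) (V m (hist pi m o) + dot (C m.+1 o) x)%R)).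
    have mnext : measurable_fun setT
        (fun o => V m (hist pi m o) + dot (C m.+1 o) x)%R.
      apply: measurable_funD.
        exact: measurableT_comp (mV m) (measurable_hist mpi m).
      exact: measurableT_comp (measurable_dot x) _.
    rewrite /I -ge0_integralD//.
    - apply: eq_integral => o _.
      rewrite /At /skip /N /V /= plays_rcons ?total_rcons//.
      case: (eqVneq (pi (hist pi m o)) x) => [pix|npix] /=.
        rewrite andbF mul0e add0e addn1; congr (_ * _).
          rewrite /b /play /N pix eqxx.
          by case: (k) => [//|k']; rewrite eqSS andbT.
        by rewrite pix.
      rewrite addn0 addr0 andbT.
      rewrite (_ : b _ = false) ?mul0e ?adde0//.
      by rewrite /b /play (negbTE npix); case: (k) => // k'; rewrite andbF.
    - by move=> o _; apply: term0 => //; exact: walk_ge0.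
    - by apply: mterm; [exact: m_skip|exact: measurable_walk].
    - by move=> o _; apply: term0 => //; exact: walk_ge0.
    - apply: emeasurable_funM.
        apply/measurable_EFinP.
        exact: measurableT_comp (mbool _ _ mb) (measurable_hist mpi m).
      by apply: measurableT_comp => //; exact: measurable_walk.
  congr (_ + _).
  rewrite (@integral_next_cost pi mpi m (fun y => (b y)%:R)%R (V m)
    (walk (s - k)) x (mbool _ _ mb) _ (mV m) (measurable_walk _) (walk_ge0 _))//.
  rewrite /b; case: k ks {b mb} => [|k] ks.
    by rewrite [LHS]integral0_eq// => o _; rewrite mul0e.
  apply: eq_integral => o _; congr (_ * _).
  by rewrite -[(s - k)%N]prednK ?subn_gt0// -subnS.
pose Phi m := \sum_(k < s.+1) I m (At m k) (walk (s - k)).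
have Phi_le m : (s0 <= m)%N -> Phi m.+1 <= Phi m.
  move=> s0m; rewrite /Phi.
  rewrite (eq_bigr _ (fun (k : 'I_s.+1) _ => step m k s0m (ltn_ord k))).
  rewrite [leRHS](eq_bigr _ (fun (k : 'I_s.+1) _ =>
    EI m k _ (measurable_walk _) (walk_ge0 _))).
  rewrite [leLHS]big_split [leRHS]big_split /=; apply: leeD2l.
  (* The played terms are shifted by one: the left sum starts with 0 and lacks the term of count
     [s], which is nonnegative. *)
  rewrite big_ord_recl add0e big_ord_recr /= leeDl//; exact/I0/walk_ge0.
have Phi0 : Phi s0 = walk s 0%R.
  have N0 o : N s0 (hist pi s0 o) = 0%N by rewrite /N plays0// size_tuple.
  have V0 o : V s0 (hist pi s0 o) = 0%R by rewrite /V total0// size_tuple.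
  rewrite /Phi big_ord_recl big1 => [|k _].
    rewrite adde0 /I /At; under eq_integral do rewrite N0 V0 eqxx mul1e.
    by rewrite integral_cst//= probability_setT mule1 subn0.
  by rewrite /I /At [LHS]integral0_eq// => o _; rewrite N0 mul0e.
have Phi_walk : Phi n <= walk s 0%R.
  rewrite -(subnKC s0n); elim: (n - s0)%N => [|m ih]; first by rewrite addn0 Phi0.
  by rewrite addnS (le_trans (Phi_le _ _))// leq_addr.
apply: le_trans Phi_walk.
(* Only the count [s] is kept: there [walk 0] is the indicator of [D], and the term is the
   probability wanted. *)
rewrite /Phi big_ord_recr/= (le_trans _ (leeDr _ _))//; last first.
  by apply: sume_ge0 => k _; exact/I0/walk_ge0.
rewrite subnn /I /=.
have mset : measurable [set o | At n s (hist pi n o) /\ D (V n (hist pi n o))].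
  apply: measurableI.
    rewrite -[X in measurable X]setTI.
    exact: (measurableT_comp (mN n s) (measurable_hist mpi n) measurableT
      (Y := [set true])).
  rewrite -[X in measurable X]setTI.
  exact: (measurableT_comp (mV n) (measurable_hist mpi n) measurableT (Y := D)).
have -> : P [set o | plays pi s0 x (hist pi n o) = s /\
    D (total pi s0 x (hist pi n o))] =
    \int[P]_o (\1_[set o | At n s (hist pi n o) /\ D (V n (hist pi n o))] o)%:E.
  rewrite integral_indic ?setIT//.
  by congr (P _); apply/seteqP; split => o /= [/eqP].
rewrite le_eqVlt; apply/orP; left; apply/eqP.
apply: eq_integral => o _; rewrite -EFinM; congr EFin.
rewrite !indicE; case: (boolP (At _ _ _)) => [atS|natS] /=.
  rewrite mul1r; congr (_%:R); congr nat_of_bool.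
  by apply/idP/idP; rewrite !inE// => -[].
rewrite mul0r (_ : o \in _ = false)//.
by apply/negbTE/negP; rewrite inE /= => -[]; rewrite (negbTE natS).
Qed.

End adaptive_sampling.

Arguments measurable_hist {R d disp Omega P} C [pi] mpi n.
Arguments hist_independent {R d disp Omega P C} C_iid [pi] mpi n.

(** * Expected costs *)

Lemma dot_sum (R : realType) (d : nat) (c : d.-tuple R) (I : Type) (r : seq I)
    (a : I -> R) (X : I -> 'rV[R]_d) :
  dot c (\sum_(i <- r) a i *: X i) = \sum_(i <- r) a i * dot c (X i).
Proof.
rewrite /dot; under eq_bigr do rewrite summxE mulr_sumr.
rewrite exchange_big; apply: eq_bigr => k _.
by rewrite mulr_sumr; apply: eq_bigr => j _; rewrite mxE mulrCA.
Qed.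

Lemma dot_delta (R : realType) (d : nat) (c : d.-tuple R) i :
  dot c (delta_mx 0 i) = tnth c i.
Proof.
rewrite /dot (bigD1 i)//= big1 => [|j ji].
  by rewrite mxE !eqxx mulr1 addr0.
by rewrite mxE (negbTE ji) andbF mulr0.
Qed.

(** The span of the chosen actions has dimension [d], hence is everything. Properties assumed for
    actions thereby reach the unit vectors. *)
Lemma full_dimensional_span (R : realType) (d : nat) (U : set 'rV[R]_d)
    (v : 'rV[R]_d) :
  full_dimensional U -> exists (r : seq (R * 'rV[R]_d)),
    (forall p, p \in r -> U p.2) /\ v = \sum_(p <- r) p.1 *: p.2.
Proof.
move=> [X XU dimX].
have vX : v \in <<in_tuple X>>%VS.
  rewrite (_ : <<_>>%VS = fullv) ?memvf//; apply/eqP.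
  by rewrite eqEdim subvf /= dimvf /dim /= mul1n dimX.
exists [seq (coord (in_tuple X) i v, X`_i) | i <- index_enum 'I_(size X)]; split.
  by move=> p /mapP[i _ ->] /=; apply: XU; rewrite /= mem_nth.
by rewrite big_map [LHS](coord_span vX).
Qed.

Section integrability.
Local Open Scope ereal_scope.
Context {R : realType} {disp : measure_display} {Omega : measurableType disp}
  (P : probability Omega R).

(** By [t <= expR t] at [t = u0 * X] and [t = - u0 * X], the modulus of [X] is at most
    [(expR (u0 * X) + expR (- u0 * X)) / u0], which is integrable by hypothesis. *)
Lemma light_tailed_integrable (u0 : R) (X : Omega -> R) :
  (0 < u0)%R -> measurable_fun setT X -> light_tailed P u0 X ->
  P.-integrable setT (EFin \o X).
Proof.
move=> u0_gt0 mX light.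
have intexp u : (`|u| <= u0)%R ->
    P.-integrable setT (fun o => (expR (u * X o))%:E).
  move=> /light; rewrite unlock => lty.
  apply/integrableP; split.
    apply/measurable_EFinP; apply: measurableT_comp => //.
    exact: measurable_funM.
  rewrite (eq_integral (fun o => (expR (u * X o))%:E))// => o _.
  by rewrite gee0_abs// lee_fin expR_ge0.
have int2 : P.-integrable setT (fun o =>
    (u0^-1)%:E * ((expR (u0 * X o))%:E + (expR (- u0 * X o))%:E)).
  apply: integrableZl => //; apply: integrableD => //; apply: intexp.
    by rewrite gtr0_norm.
  by rewrite normrN gtr0_norm.
apply: le_integrable int2 => //; first exact/measurable_EFinP.
move=> o _; rewrite -EFinD -EFinM /= lee_fin.
have exp_ge (t : R) : (t <= expR t)%R.
  by rewrite (le_trans _ (expR_ge1Dx t))// lerDr.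
rewrite [leRHS]ger0_norm; last first.
  by rewrite mulr_ge0 ?addr_ge0 ?expR_ge0// invr_ge0 ltW.
rewrite ler_pdivlMl// -[X in (X * _ <= _)%R](gtr0_norm u0_gt0) -normrM.
rewrite ler_norml; apply/andP; split.
  rewrite lerNl -mulNr (le_trans (exp_ge _))// lerDr expR_ge0//.
by rewrite (le_trans (exp_ge _))// lerDl expR_ge0.
Qed.

End integrability.

Section expected_cost.
Local Open Scope ereal_scope.
Context {R : realType} {d : nat} {disp : measure_display}
  {Omega : measurableType disp} (P : probability Omega R)
  (C : nat -> {RV P >-> d.-tuple R}).
Hypothesis C_iid : iid P (fun n : nat => C n.+1).
Variables (U : set 'rV[R]_d) (u0 : R).
Hypothesis u0_gt0 : (0 < u0)%R.
Hypothesis U_compact : compact U.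
Hypothesis U_dim : full_dimensional U.
Hypothesis cost_light :
  forall x, U x -> light_tailed P u0 (fun o => dot (C 1%N o) x).

(** The light tail is assumed for actions at time 1: a unit vector is a combination of actions, and
    equality of laws reaches the other times. *)
Lemma integrable_coordinate n i :
  P.-integrable setT (fun o => (tnth (C n.+1 o) i)%:E).
Proof.
have mcoord m : measurable_fun setT (fun o => tnth (C m o) i).
  exact: measurableT_comp (measurable_tnth i) _.
have int1 : P.-integrable setT (fun o => (tnth (C 1%N o) i)%:E).
  have [r [rU ei]] := full_dimensional_span (delta_mx 0%R i) U_dim.
  rewrite (_ : (fun _ => _) =
      fun o => \sum_(p <- r | p \in r) (p.1)%:E * (dot (C 1%N o) p.2)%:E).
    apply: integrable_sum => // p pr; apply: integrableZl => //.
    apply: light_tailed_integrable u0_gt0 _ (cost_light (rU _ pr)).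
    exact: measurableT_comp (measurable_dot _) _.
  apply/funext => o; rewrite -big_seq -dot_delta ei dot_sum -sumEFin.
  by apply: eq_bigr => p _; rewrite EFinM.
have mtnth : measurable_fun [set: d.-tuple R] (fun c => (tnth c i)%:E).
  by apply/measurable_EFinP; exact: measurable_tnth.
have lawE m : \int[P]_o `|(tnth (C m o) i)%:E| =
    \int[distribution P (C m)]_c `|(tnth c i)%:E|.
  by rewrite ge0_integral_distribution//; exact: measurableT_comp.
apply/integrableP; split; first exact/measurable_EFinP.
by rewrite lawE (integral_law C_iid) -lawE; have /integrableP[] := int1.
Qed.

Arguments integrable_coordinate n i : clear implicits.

Let mean i : R := fine 'E_P[fun o => tnth (C 1%N o) i].

Lemma mean_costE x : mean_cost P C x = (\sum_(i < d) mean i * x 0%R i)%R.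
Proof.
rewrite /mean_cost unlock; under eq_integral do rewrite /dot -sumEFin.
rewrite integral_sum//; last first.
  move=> i; under eq_fun do rewrite EFinM muleC.
  by apply: integrableZl => //; exact: integrable_coordinate.
have -> // : \sum_(i < d) \int[P]_o (tnth (C 1%N o) i * x 0%R i)%:E =
    (\sum_(i < d) mean i * x 0%R i)%:E.
rewrite -sumEFin; apply: eq_bigr => i _; under eq_integral do rewrite EFinM.
rewrite integralZr//; last exact: integrable_coordinate.
by rewrite EFinM /mean unlock fineK// integrable_fin_num//; exact: integrable_coordinate.
Qed.

Lemma mean_cost_sum (I : Type) (r : seq I) (a : I -> R) (X : I -> 'rV[R]_d) :
  mean_cost P C (\sum_(i <- r) a i *: X i)%R =
  (\sum_(i <- r) a i * mean_cost P C (X i))%R.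
Proof.
rewrite mean_costE; under eq_bigr do rewrite summxE mulr_sumr.
rewrite exchange_big; apply: eq_bigr => k _; rewrite mean_costE mulr_sumr.
by apply: eq_bigr => j _; rewrite mxE mulrCA.
Qed.

Lemma compact_coordinate_bound :
  exists k : R, forall x, U x -> forall i, (`|x 0%R i| <= k)%R.
Proof.
have [k [_ Uk]] := compact_bounded U_compact.
(* Boundedness supplies every bound strictly above [k], hence [k + 1]. *)
exists (k + 1)%R => x Ux i.
have k1 : (k < k + 1)%R by rewrite ltrDl.
apply: le_trans (Uk _ k1 x Ux); rewrite [leRHS]/Num.Def.normr /= mx_normrE.
by apply/bigmax_geP; right => /=; exists (0%R, i).
Qed.

Variable pi : policy R d.
Hypothesis mpi : measurable_policy pi.
Hypothesis piU : forall n o, U (pi (hist C pi n o)).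

(** The action is a function of the past, which is independent of [C n.+1]. In each coordinate, a
    bounded action entry times an integrable cost entry has an expectation that factors. *)
Lemma integrable_cost n :
  P.-integrable setT (fun o => (dot (C n.+1 o) (pi (hist C pi n o)))%:E) /\
  'E_P[fun o => dot (C n.+1 o) (pi (hist C pi n o))] =
  'E_P[fun o => mean_cost P C (pi (hist C pi n o))].
Proof.
have [k Uk] := compact_coordinate_bound.
pose Y : {mfun Omega >-> n.-tuple R} :=
  mfun_Sub (mem_set (measurable_hist C mpi n)).
have ind (i : 'I_d) := @independent_mul _ _ _ _ _ _ _ P Y (C n.+1)
  (fun y => pi y 0%R i) (fun c => tnth c i) k
  (hist_independent C_iid mpi n) (@mpi n i) (measurable_tnth i)
  (fun o => Uk _ (piU n o) i) (integrable_coordinate n i).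
have intV (i : 'I_d) : P.-integrable setT (fun o => (pi (hist C pi n o) 0%R i)%:E).
  apply: (le_integrable _ _ _ (finite_measure_integrable_cst P k measurableT)) => //.
    apply/measurable_EFinP.
    exact: measurableT_comp (@mpi n i) (measurable_hist C mpi n).
  move=> o _ /=; rewrite lee_fin (le_trans (Uk _ (piU n o) i))// ler_norm//.
have intVW (i : 'I_d) : P.-integrable setT
    (fun o => (tnth (C n.+1 o) i * pi (hist C pi n o) 0%R i)%:E).
  by under eq_fun do rewrite mulrC; exact: (ind i).1.
split.
  rewrite (_ : (fun _ => _) = fun o =>
    \sum_(i < d) (tnth (C n.+1 o) i * pi (hist C pi n o) 0%R i)%:E).
    exact: integrable_sum.
  by apply/funext => o; rewrite sumEFin.
have mean_n i : 'E_P[fun o => tnth (C n.+1 o) i] = (mean i)%:E.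
  rewrite /mean fineK unlock.
    have tnthlaw m : \int[P]_o (tnth (C m.+1 o) i)%:E =
        \int[distribution P (C m.+1)]_c (tnth c i)%:E.
      rewrite (@integral_distribution _ _ _ _ _ P (C m.+1) (fun c => (tnth c i)%:E))//.
        by apply/measurable_EFinP; exact: measurable_tnth.
      exact: integrable_coordinate.
    by rewrite !tnthlaw (integral_law C_iid).
  by rewrite integrable_fin_num//; exact: integrable_coordinate.
transitivity (\sum_(i < d) \int[P]_o (mean i * pi (hist C pi n o) 0%R i)%:E).
  rewrite unlock; under eq_integral do rewrite /dot -sumEFin.
  rewrite integral_sum//; apply: eq_bigr => i _.
  under eq_integral do rewrite mulrC.
  have := (ind i).2; rewrite unlock => ->.
  under [RHS]eq_integral do rewrite EFinM.
  rewrite integralZl// muleC; congr (_ * _).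
  by have := mean_n i; rewrite unlock.
rewrite expectation.unlock; under [RHS]eq_integral do rewrite mean_costE -sumEFin.
rewrite integral_sum// => i; under eq_fun do rewrite EFinM.
exact: integrableZl.
Qed.

Lemma measurable_mean_cost n :
  measurable_fun setT (fun o => mean_cost P C (pi (hist C pi n o))).
Proof.
under eq_fun do rewrite mean_costE.
apply: measurable_sum => i; apply: measurable_funM => //.
exact: measurableT_comp (@mpi n i) (measurable_hist C mpi n).
Qed.

Variable xstar : 'rV[R]_d.
Hypothesis xstar_opt : optimal_action P C U xstar.

Let gap x : R := (mean_cost P C x - mean_cost P C xstar)%R.

(** Index [n] stands for time [n.+1], whose action depends on a history of length [n]. Integrability
    justifies exchanging sum and expectation before passing to mean costs. *)
Lemma regret_gap T : regret P (fun t o => C t o) xstar pi T =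
  \sum_(n < T) 'E_P[fun o => gap (pi (hist C pi n o))].
Proof.
have [xstarU xstar_min] := xstar_opt.
have [k Uk] := compact_coordinate_bound.
have intstar n : P.-integrable setT (fun o => (dot (C n.+1 o) xstar)%:E).
  rewrite (_ : (fun _ => _) = fun o =>
    \sum_(i < d) (xstar 0%R i)%:E * (tnth (C n.+1 o) i)%:E).
    apply: integrable_sum => // i _.
    by apply: integrableZl => //; exact: integrable_coordinate.
  apply/funext => o; rewrite -sumEFin; apply: eq_bigr => i _.
  by rewrite mulrC EFinM.
have estar n : \int[P]_o (dot (C n.+1 o) xstar)%:E = (mean_cost P C xstar)%:E.
  have dotlaw m : \int[P]_o (dot (C m.+1 o) xstar)%:E =
      \int[distribution P (C m.+1)]_c (dot c xstar)%:E.
    rewrite (@integral_distribution _ _ _ _ _ P (C m.+1)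
      (fun c => (dot c xstar)%:E))//.
      by apply/measurable_EFinP; exact: measurable_dot.
    exact: intstar.
  rewrite /mean_cost unlock fineK ?integrable_fin_num//.
  by rewrite !dotlaw (integral_law C_iid).
rewrite /regret expectation.unlock.
under eq_integral => o _ do rewrite big_add1 /= big_mkord -sumEFin.
have intdiff n : P.-integrable setT (fun o =>
    (dot (C n.+1 o) (action pi (fun t o => C t o) n.+1 o) -
     dot (C n.+1 o) xstar)%:E).
  under eq_fun do rewrite /action -histE EFinB.
  by apply: integrableB => //; exact: (integrable_cost n).1.
rewrite integral_sum//; apply: eq_bigr => n _.
under eq_integral do rewrite /action -histE EFinB.
rewrite integralB//; last exact: (integrable_cost n).1.
have := (integrable_cost n).2; rewrite unlock => ->; rewrite estar.
under [RHS]eq_integral do rewrite /gap EFinB.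
have intm : P.-integrable setT (fun o => (mean_cost P C (pi (hist C pi n o)))%:E).
  pose k' := (\sum_(i < d) `|mean i| * k)%R.
  apply: (le_integrable _ _ _ (finite_measure_integrable_cst P k' measurableT)) => //.
    by apply/measurable_EFinP; exact: measurable_mean_cost.
  move=> o _ /=; rewrite lee_fin (le_trans _ (ler_norm k'))// mean_costE.
  rewrite (le_trans (ler_norm_sum _ _ _))// ler_sum// => i _.
  by rewrite normrM ler_wpM2l// Uk.
rewrite integralB//; last exact: finite_measure_integrable_cst.
by rewrite integral_cst//= probability_setT mule1.
Qed.

End expected_cost.

(** * Exploration times *)

Section exploration.
Context {R : realType} (d : nat) (w : R).

Let A := exploration d w.

Lemma exploration_le t s : s \in A t -> (s <= t)%N.
Proof.
elim: t => // t ih; rewrite [A t.+1]/A /= -/(A t).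
case: ifP => _; last by move=> /ih /leqW.
by rewrite mem_rcons inE => /orP[/eqP -> //|/ih /leqW].
Qed.

(** Earlier exploration times are at most [t], so the membership of [t.+1] is decided by its own
    test. *)
Lemma mem_explorationS t :
  (t.+1 \in A t.+1) = (t == 0%N) ||
    ((size (A t))%:Z < d%:Z * Num.ceil (d%:R ^+ 2 * w * ln t.+1%:R)).
Proof.
rewrite /A /= -/(A t); case: ifP => _; first by rewrite mem_rcons mem_head.
by apply/negP => /exploration_le; rewrite ltnn.
Qed.

Lemma size_explorationS t : size (A t.+1) = (size (A t) + (t.+1 \in A t.+1))%N.
Proof.
rewrite mem_explorationS /A /= -/(A t).
by case: ifP => _; rewrite ?size_rcons ?addn1 ?addn0.
Qed.

(** A time after the first is added only while the count is below a threshold that increases with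
    [t]; [Num.ceil x < x + 1] removes the rounding. The leading 1 pays for time 1, always included,
    and for the time just added. *)
Lemma size_exploration_le t : 0 <= w -> (0 < t)%N ->
  (size (A t))%:R <= 1 + d%:R * (d%:R ^+ 2 * w * ln t%:R + 1) :> R.
Proof.
move=> w0 t0.
have base s : (0 < s)%N -> 0 <= d%:R * (d%:R ^+ 2 * w * ln s%:R + 1) :> R.
  move=> s0; rewrite mulr_ge0// addr_ge0// mulr_ge0 ?ln_ge0 ?ler1n//.
  by rewrite mulr_ge0// exprn_ge0.
have mono s : (0 < s)%N -> d%:R * (d%:R ^+ 2 * w * ln s%:R + 1) <=
    d%:R * (d%:R ^+ 2 * w * ln s.+1%:R + 1) :> R.
  move=> s0; rewrite ler_wpM2l// lerD2r ler_wpM2l ?mulr_ge0 ?exprn_ge0//.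
  by rewrite ler_ln ?posrE ?ltr0n// ler_nat.
case: t t0 => // t _; elim: t => [|t ih].
  by rewrite size_explorationS mem_explorationS lerDl base.
rewrite size_explorationS mem_explorationS /=.
case: ltP => [lt_size|_]; last by rewrite addn0 (le_trans ih)// lerD2l mono.
rewrite addn1 -natr1 addrC lerD2l.
have lt_sizeR : (size (A t.+1))%:R < d%:R *
    (Num.ceil (d%:R ^+ 2 * w * ln t.+2%:R))%:~R :> R.
  by move: lt_size; rewrite -(ltr_int R) intrM.
rewrite (le_trans (ltW lt_sizeR))// ler_wpM2l// ltW//.
by rewrite -ltrBlDr; have := ceilB1_lt (d%:R ^+ 2 * w * ln t.+2%:R); rewrite intrB.
Qed.

(** A failed inclusion test means that the count has reached the threshold; [m] is the ceiling as a
    natural number. Time 1 always explores, hence [0 < t]. *)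
Lemma exploitation_size t : 0 <= w -> t.+1 \notin A t.+1 ->
  (0 < t)%N /\ exists m : nat,
    d%:R ^+ 2 * w * ln t.+1%:R <= m%:R :> R /\ (d * m <= size (A t))%N.
Proof.
move=> w0; rewrite mem_explorationS negb_or -leNgt lt0n => /andP[-> thr].
split => //; set x : R := _ * ln _ in thr *.
have x0 : 0 <= x.
  by rewrite /x mulr_ge0 ?ln_ge0 ?ler1n// mulr_ge0// exprn_ge0.
have ceil0 : 0 <= Num.ceil x by rewrite ceil_ge0 (lt_le_trans _ x0)// ltrN10.
exists `|Num.ceil x|%N; split.
  by rewrite (le_trans (ceil_ge x))// -[X in X%:~R <= _]gez0_abs.
by rewrite -lez_nat PoszM gez0_abs.
Qed.

End exploration.

(** Exploration is round-robin, with [j] the number of exploration times already past: this counts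
    the turns of spanner element [i] among the first [n]. *)
Definition residue_count (d i n : nat) : nat := (\sum_(j < n) (j %% d == i))%N.

(** Each full block of [d] consecutive indices contains the residue [i] once. *)
Lemma residue_count_ge (d i m n : nat) : (i < d)%N -> (d * m <= n)%N ->
  (m <= residue_count d i n)%N.
Proof.
move=> lt_id dmn; apply: (@leq_trans (residue_count d i (d * m))).
  elim: m {n dmn} => // m ih.
  rewrite mulnS addnC /residue_count big_split_ord /= -addn1 leq_add//.
  rewrite (bigD1 (Ordinal lt_id))//=.
  by rewrite mulnC modnMDl modn_small// eqxx.
rewrite /residue_count -(subnKC dmn) big_split_ord /=; exact: leq_addr.
Qed.

Lemma residue_countS (d i n : nat) :
  residue_count d i n.+1 = (residue_count d i n + (n %% d == i))%N.
Proof. by rewrite /residue_count big_ord_recr. Qed.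

(** * Actions and play counts within one epoch *)

Section epoch.
Context {R : realType} {d : nat} {disp : measure_display}
  {Omega : measurableType disp} (P : probability Omega R)
  (C : nat -> {RV P >-> d.-tuple R}) (d_gt0 : (0 < d)%N).
Variables (U : set 'rV[R]_d) (B : 'I_d -> 'rV[R]_d)
  (coef : 'rV[R]_d -> 'I_d -> R) (len : nat -> nat) (w : nat -> R)
  (pi : policy R d).
Hypothesis BU : forall i, U (B i).
Hypothesis pi_epoch : epoch_policy U B coef len w pi.

(** At count [n + 1] the one-based [oslash] is the successor of [n %% d], where [n] is the count
    before time [t.+1]. *)
Lemma epoch_explore k t h : (t < len k)%N ->
  size h = (epoch_start len k + t)%N ->
  t.+1 \in exploration d (w k) t.+1 ->
  forall i : 'I_d, i = (size (exploration d (w k) t) %% d)%N :> nat -> pi h = B i.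
Proof.
move=> tk hsz tA i iE; have := pi_epoch (k := k) (t := t.+1) (h := h) tk hsz.
rewrite /= tA; apply.
by rewrite -[RHS]/(oslash (size (exploration d (w k) t.+1)) d)
  size_explorationS tA addn1 /oslash /= iE.
Qed.

Lemma epoch_exploit k t h : (t < len k)%N ->
  size h = (epoch_start len k + t)%N ->
  t.+1 \notin exploration d (w k) t.+1 ->
  U (pi h) /\ forall y, U y ->
    estimate B coef pi (epoch_start len k) h (pi h) <=
    estimate B coef pi (epoch_start len k) h y.
Proof.
move=> tk hsz /negbTE tA; have := pi_epoch (k := k) (t := t.+1) (h := h) tk hsz.
by rewrite /= tA.
Qed.

Lemma epoch_action k t h : (t < len k)%N ->
  size h = (epoch_start len k + t)%N -> U (pi h).
Proof.
move=> tk hsz.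
have [tA|tA] := boolP (t.+1 \in exploration d (w k) t.+1); last first.
  by have [] := epoch_exploit tk hsz tA.
pose i := Ordinal (ltn_pmod (size (exploration d (w k) t)) d_gt0).
by rewrite (epoch_explore tk hsz tA (i := i)).
Qed.

(** Induction on time along the round-robin. Only an inequality can hold, since exploitation may
    also choose [B i] and [plays] counts those times too. *)
Lemma plays_ge k t o (i : 'I_d) : (t <= len k)%N ->
  (residue_count d i (size (exploration d (w k) t)) <=
   plays pi (epoch_start len k) (B i) (hist C pi (epoch_start len k + t) o))%N.
Proof.
elim: t => [|t ih] tk; first by rewrite /residue_count big_ord0.
rewrite addnS /= plays_rcons ?size_tuple ?leq_addr//.
rewrite size_explorationS; case: (boolP (_ \in _)) => tA; last first.
  by rewrite addn0 (leq_trans (ih (ltnW tk)))// leq_addr.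
rewrite addn1 residue_countS; apply: leq_add; first exact/ih/ltnW.
have [si|//] := eqVneq (size (exploration d (w k) t) %% d)%N (i : nat).
by rewrite (epoch_explore (i := i) tk _ tA) ?size_tuple ?eqxx.
Qed.

End epoch.

Lemma epoch_decomposition (len : nat -> nat) n :
  (forall k, (0 < len k)%N) ->
  exists k t, (t < len k)%N /\ n = (epoch_start len k + t)%N.
Proof.
move=> len0; elim: n => [|n [k [t [tk ->]]]].
  by exists 0%N, 0%N; split => //; rewrite /epoch_start big_ord0.
have [tk'|] := ltnP t.+1 (len k); first by exists k, t.+1; rewrite addnS.
move=> kt; exists k.+1, 0%N; split => //.
rewrite /epoch_start big_ord_recr /= addn0 -addnS; congr addn.
by apply/eqP; rewrite eqn_leq tk kt.
Qed.

(** * Exploitation *)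

Section exploitation.
Context {R : realType} {d : nat} {disp : measure_display}
  {Omega : measurableType disp} (P : probability Omega R)
  (C : nat -> {RV P >-> d.-tuple R}) (d_gt0 : (0 < d)%N).
Hypothesis C_iid : iid P (fun n : nat => C n.+1).
Variables (a zeta u0 b : R).
Hypotheses (zeta_gt0 : 0 < zeta) (u0_gt0 : 0 < u0) (a_gt0 : 0 < a)
  (b_gt : 2 / a < b).

(** The minimum keeps [delta] in the range of the deviation bound. The two lower bounds on [w]
    answer its two branches, each giving [delta^2 d^2 w >= b]; as [a b >= 2], the exponent is at
    least [2 ln t.+1]. *)
Lemma deviation_exponent (c w : R) (t m s : nat) (delta : R) :
  0 < c -> (0 < t)%N ->
  b / (d%:R * zeta * u0) ^+ 2 <= w -> 4 * b / c ^+ 2 <= w ->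
  delta = Num.min (c / (2 * d%:R)) (zeta * u0) ->
  d%:R ^+ 2 * w * ln t.+1%:R <= m%:R -> (m <= s)%N ->
  expR (- a * delta ^+ 2 * s%:R) <= (t.+1%:R ^+ 2)^-1.
Proof.
move=> c0 t0 w1 w2 deltaE dm ms.
have d0 : 0 < d%:R :> R by rewrite ltr0n.
have zu0 : 0 < zeta * u0 by rewrite mulr_gt0.
have ab2 : 2 <= a * b by rewrite mulrC -ler_pdivrMr// ltW.
have b0 : 0 < b by rewrite (le_lt_trans _ b_gt)// divr_ge0// ltW.
have bdw : b <= delta ^+ 2 * (d%:R ^+ 2 * w).
  rewrite deltaE; have [_|_] := leP (c / (2 * d%:R)) (zeta * u0).
    rewrite (_ : _ * _ = w * c ^+ 2 / 4); last by field; rewrite gt_eqF.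
    by rewrite ler_pdivlMr// mulrC -ler_pdivrMr ?exprn_gt0.
  rewrite (_ : _ * _ = w * (d%:R * zeta * u0) ^+ 2); last by ring.
  by rewrite -ler_pdivrMr// exprn_gt0// !mulr_gt0.
have ln0 : 0 <= ln t.+1%:R :> R by rewrite ln_ge0// ler1n.
have -> : (t.+1%:R ^+ 2)^-1 = expR (- (ln t.+1%:R * 2)) :> R.
  by rewrite expRN; congr (_^-1); rewrite expRM_natr lnK// posrE ltr0n.
rewrite ler_expR !mulNr lerN2.
apply: (@le_trans _ _ (a * delta ^+ 2 * (d%:R ^+ 2 * w * ln t.+1%:R))).
  rewrite (_ : a * _ * _ = ln t.+1%:R * (a * (delta ^+ 2 * (d%:R ^+ 2 * w))));
    last by ring.
  by rewrite ler_wpM2l// (le_trans ab2)// ler_pM2l.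
apply: ler_wpM2l; first by rewrite mulr_ge0 ?sqr_ge0// ltW.
by rewrite (le_trans dm)// ler_nat.
Qed.

Variables (U : set 'rV[R]_d) (xstar : 'rV[R]_d) (M : R) (B : 'I_d -> 'rV[R]_d)
  (coef : 'rV[R]_d -> 'I_d -> R) (len : nat -> nat) (w : nat -> R)
  (pi : policy R d).
Hypothesis U_compact : compact U.
Hypothesis U_dim : full_dimensional U.
Hypothesis cost_light :
  forall x, U x -> light_tailed P u0 (fun o => dot (C 1%N o) x).
Hypothesis cost_deviation : forall x, U x ->
  deviation_bound P a zeta u0 (fun n o => dot (C n.+1 o) x).
Hypothesis xstar_opt : optimal_action P C U xstar.
Hypothesis gap_le :
  forall x, U x -> mean_cost P C x - mean_cost P C xstar <= M.
Hypothesis B_spanner : barycentric_spanner U B.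
Hypothesis coef_bary : forall x, U x -> bary_coordinates B x (coef x).
Hypothesis mpi : measurable_policy pi.
Hypothesis pi_epoch : epoch_policy U B coef len w pi.

Let gap x : R := mean_cost P C x - mean_cost P C xstar.

(** The [t] costs seen in the epoch allow [t.+1] values for the number of plays, whence the factor.
    For each value, [adaptive_sampling] compares with i.i.d. samples, to which the deviation bound
    applies. *)
Lemma sample_mean_deviation s0 t m (i : 'I_d) (delta r : R) :
  0 <= delta <= zeta * u0 -> (0 < m)%N -> 0 <= r ->
  (forall s, (m <= s)%N -> expR (- a * delta ^+ 2 * s%:R) <= r) ->
  exists bad : set Omega, [/\ measurable bad,
    (P bad <= (t.+1%:R * (2 * r))%:E)%E &
    forall o, ~ bad o -> (m <= plays pi s0 (B i) (hist C pi (s0 + t) o))%N ->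
      `|sample_mean pi s0 (hist C pi (s0 + t) o) (B i) - mean_cost P C (B i)|
        < delta].
Proof.
move=> delta_range m0 r0 exp_le; set n := (s0 + t)%N.
pose dev s : set R :=
  [set y | delta <= `|s%:R^-1 * y - mean_cost P C (B i)|].
have mdev s : measurable (dev s).
  rewrite -[dev s]setTI; apply: measurable_fun_le => //.
  by apply: measurableT_comp => //; exact: measurable_funB.
pose E s := [set o | (m <= s)%N /\ (plays pi s0 (B i) (hist C pi n o) = s /\
  dev s (total pi s0 (B i) (hist C pi n o)))].
have m_plays : measurable_fun setT
    (fun o => (plays pi s0 (B i) (hist C pi n o))%:R : R).
  exact: measurableT_comp (measurable_plays mpi s0 (B i) (n:=n))
    (measurable_hist C mpi n).
have m_total : measurable_fun setT (fun o => total pi s0 (B i) (hist C pi n o)).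
  exact: measurableT_comp (measurable_total mpi s0 (B i) (n:=n))
    (measurable_hist C mpi n).
have mE s : measurable (E s).
  rewrite (_ : E s = (if (m <= s)%N then setT else set0) `&`
    ((fun o => (plays pi s0 (B i) (hist C pi n o))%:R : R) @^-1` [set s%:R : R] `&`
     (fun o => total pi s0 (B i) (hist C pi n o)) @^-1` dev s)).
    apply: measurableI; first by case: ifP.
    by apply: measurableI; rewrite -[X in measurable X]setTI;
      [exact: m_plays|exact: m_total].
  apply/seteqP; split => o /=.
    by move=> [-> [-> ?]].
  move=> [+ [/eqP + devo]]; rewrite eqr_nat => + /eqP es.
  by case: ifP => // ms _; split.
(* The number of plays is random: sum over its possible values. *)
exists (\big[setU/set0]_(s < t.+1) E s); split.
- by apply: bigsetU_measurable.
- apply: (le_trans (Boole_inequality _ (fun s _ => mE s))).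
  have -> : (t.+1%:R * (2 * r))%:E = (\sum_(s < t.+1) (2 * r)%:E)%E.
    by rewrite sumEFin sumr_const card_ord mulr_natl.
  apply: lee_sum => s _.
  have [ms|ms] := leqP m s; last first.
    rewrite (_ : E s = set0) ?measure0 ?lee_fin ?mulr_ge0//.
    by apply/seteqP; split => o //= [+ _]; rewrite leqNgt ms.
  have s0_gt : (0 < s)%N by exact: leq_trans ms.
  apply: (@le_trans _ _ (2 * expR (- a * delta ^+ 2 * s%:R))%:E); last first.
    by rewrite lee_fin ler_wpM2l// exp_le.
  apply: le_trans (cost_deviation (B_spanner.1 i) s0_gt delta_range).
  rewrite (_ : E s = [set o | plays pi s0 (B i) (hist C pi n o) = s /\
      dev s (total pi s0 (B i) (hist C pi n o))]).
    exact: (adaptive_sampling C_iid (B i) (mdev s) mpi s (leq_addr t s0)).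
  by apply/seteqP; split => o /=; [case|split].
- move=> o nbad mplays; rewrite ltNge; apply/negP => dev_o.
  have plays_le : (plays pi s0 (B i) (hist C pi n o) < t.+1)%N.
    rewrite /plays size_tuple ltnS.
    rewrite (leq_trans (_ : _ <= \sum_(s0 <= s < n) 1)%N)//.
      by rewrite big_mkcond leq_sum// => s _; case: ifP.
    by rewrite sum_nat_const_nat muln1 /n addKn.
  apply: nbad; rewrite -bigcup_mkord; exists (plays pi s0 (B i) (hist C pi n o)) => //.
  by split => //; split => //; rewrite /dev /= mulrC.
Qed.

(** The gap is bounded pointwise by [c] plus [M] times the number of bad events, and this is
    integrated. Each of the [d] bad events has probability at most [2 / t.+1]. *)
Lemma exploitation_gap c k t : 0 < c -> (t < len k)%N ->
  b / (d%:R * zeta * u0) ^+ 2 <= w k -> 4 * b / c ^+ 2 <= w k ->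
  t.+1 \notin exploration d (w k) t.+1 ->
  ('E_P[fun o => gap (pi (hist C pi (epoch_start len k + t) o))] <=
   (c + 2 * M * d%:R / t.+1%:R)%:E)%E.
Proof.
move=> c0 tk w1 w2 tA; set n := (epoch_start len k + t)%N.
have [xstarU xstar_min] := xstar_opt.
have M0 : 0 <= M by rewrite (le_trans _ (gap_le xstarU))// subrr.
have d0 : 0 < d%:R :> R by rewrite ltr0n.
have ab2 : 0 < b by rewrite (le_lt_trans _ b_gt)// divr_ge0// ltW.
have wk0 : 0 < w k.
  by rewrite (lt_le_trans _ w2)// divr_gt0 ?mulr_gt0 ?exprn_gt0.
have [t0 [m [dm dA]]] := exploitation_size (ltW wk0) tA.
(* The deviation bound needs at least one sample; [0 < t] makes the logarithm positive. *)
have m0 : (0 < m)%N.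
  rewrite -(ltr_nat R) (lt_le_trans _ dm)// !mulr_gt0 ?exprn_gt0//.
  by rewrite ln_gt0// ltr1n.
pose delta := Num.min (c / (2 * d%:R)) (zeta * u0).
have delta0 : 0 <= delta by rewrite le_min !ltW ?divr_gt0 ?mulr_gt0.
have delta_range : 0 <= delta <= zeta * u0 by rewrite delta0 ge_min lexx orbT.
have r0 : 0 <= (t.+1%:R ^+ 2)^-1 :> R by rewrite invr_ge0 exprn_ge0.
have /choice[bad bad_spec] := fun i => sample_mean_deviation
  (epoch_start len k) t i delta_range m0 r0
  (fun s => deviation_exponent c0 t0 w1 w2 erefl dm).
have histU o : U (pi (hist C pi n o)).
  by apply: (epoch_action d_gt0 B_spanner.1 pi_epoch tk); rewrite size_tuple.
have gap0 x : U x -> 0 <= gap x by move=> Ux; rewrite subr_ge0 xstar_min.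
have mbad i : measurable (bad i) by have [] := bad_spec i.
have gap_bound o : gap (pi (hist C pi n o)) <= c + M * \sum_(i < d) \1_(bad i) o.
  have sum0 : 0 <= \sum_(i < d) \1_(bad i) o :> R by apply: sumr_ge0.
  (* As soon as one bad event occurs the sum of indicators is at least 1, and [M] covers the gap. *)
  have [[i bad_i]|nbad] := pselect (exists i, bad i o).
    rewrite (le_trans (gap_le (histU o)))// -[leLHS]add0r.
    apply: lerD; first exact: ltW.
    rewrite ler_peMr// (bigD1 i)//= indicE mem_set//= lerDl.
    by apply: sumr_ge0.
  rewrite (_ : \sum_(i < d) _ = 0); last first.
    apply: big1 => i _; rewrite indicE memNset// => bad_i.
    by apply: nbad; exists i.
  rewrite mulr0 addr0.
  have err y : U y ->
      `|estimate B coef pi (epoch_start len k) (hist C pi n o) y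
        - mean_cost P C y| <= c / 2.
    move=> Uy; have [yE coef1] := coef_bary Uy.
    rewrite {2}yE (mean_cost_sum C_iid u0_gt0 U_dim cost_light).
    rewrite /estimate -sumrB (le_trans (ler_norm_sum _ _ _))//.
    (* There are [d] coordinates of modulus at most 1, each with error below [delta <= c / (2 d)],
       so the total is at most [c / 2]. *)
    apply: (@le_trans _ _ (\sum_(i < d) delta)); last first.
      rewrite sumr_const card_ord -[leLHS]mulr_natl -ler_pdivlMl//.
      by rewrite ge_min (_ : c / _ = d%:R^-1 * (c / 2)) ?lexx//;
        field; rewrite gt_eqF.
    apply: ler_sum => i _; rewrite -mulrBr normrM -[leRHS]mul1r.
    apply: ler_pM => //; apply: ltW.
    have [_ _] := bad_spec i; apply; first by move=> bad_i; apply: nbad; exists i.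
    rewrite (leq_trans _ (plays_ge C pi_epoch o i (ltnW tk)))//.
    exact: residue_count_ge.
  have [_ est_min] := epoch_exploit pi_epoch (h := hist C pi n o) tk
    (size_tuple _) tA.
  (* The chosen action has an estimate no larger than that of [xstar], and two errors of [c / 2] add
     up to [c]. *)
  move: (est_min _ xstarU) (err _ xstarU) (err _ (histU o)).
  by rewrite /gap !ler_norml; set e1 := estimate _ _ _ _ _ _;
    set e2 := estimate _ _ _ _ _ _ => *; lra.
pose G o : R := c + M * \sum_(i < d) \1_(bad i) o.
apply: (@le_trans _ _ ('E_P[G])%E).
  apply: expectation_le.
  - apply: measurable_funB => //.
    exact: (measurable_mean_cost C_iid u0_gt0 U_dim cost_light).
  - apply: measurable_funD => //; apply: measurable_funM => //.
    by apply: measurable_sum => i; exact: measurable_indic.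
  - by move=> o; exact/gap0/histU.
  - by move=> o; rewrite (le_trans _ (gap_bound o))//; exact/gap0/histU.
  - by apply: aeW => o; exact: gap_bound.
rewrite expectation.unlock.
under eq_integral do rewrite /G EFinD EFinM -sumEFin.
rewrite ge0_integralD//=; first last.
- apply: emeasurable_funM => //; apply: emeasurable_sum => i.
  by apply/measurable_EFinP; exact: measurable_indic.
- move=> o _; rewrite mule_ge0 ?lee_fin//.
  by apply: sume_ge0 => i _; rewrite lee_fin.
- by move=> o _; rewrite lee_fin ltW.
rewrite integral_cst//= probability_setT mule1 EFinD leeD2l//.
rewrite ge0_integralZl//; first last.
- by move=> o _; apply: sume_ge0 => i _; rewrite lee_fin.
- apply: emeasurable_sum => i.
  by apply/measurable_EFinP; exact: measurable_indic.
rewrite ge0_integral_sum//; last first.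
  by move=> i; apply/measurable_EFinP; exact: measurable_indic.
have -> : (2 * M * d%:R / t.+1%:R)%:E =
    (M%:E * \sum_(i < d) (t.+1%:R * (2 * (t.+1%:R ^+ 2)^-1))%:E)%E.
  rewrite sumEFin sumr_const card_ord -EFinM; congr EFin.
  rewrite -mulr_natl; field; rewrite addrC; by rewrite natr1 pnatr_eq0.
apply: lee_wpmul2l; first by rewrite lee_fin.
apply: lee_sum => i _; rewrite integral_indic ?setIT//.
by have [] := bad_spec i.
Qed.

End exploitation.

(** * Rates *)

Section rates.
Context {R : realType}.

Definition rate (x : R) : R := x `^ (2 / 3) * ln x `^ (3^-1).

Lemma cbrtK (x : R) : 0 <= x -> (x `^ (3^-1)) ^+ 3 = x.
Proof.
by move=> x0; rewrite -powR_mulrn ?powR_ge0// -powRrM mulVf// powRr1.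
Qed.

Lemma ler_cbrt (x y : R) : 0 <= x -> x <= y -> x `^ (3^-1) <= y `^ (3^-1).
Proof.
by move=> x0 xy; apply: ge0_ler_powR => //; rewrite nnegrE// (le_trans x0).
Qed.

Lemma powR23 (x : R) : 0 <= x -> x `^ (2 / 3) = (x `^ (3^-1)) ^+ 2.
Proof. by move=> x0; rewrite -powR_mulrn ?powR_ge0// -powRrM mulrC. Qed.

Lemma ln_le_id (x : R) : 0 < x -> ln x <= x.
Proof.
move=> x0; have := @le_ln1Dx R (x - 1); rewrite (addrC 1) subrK => ln_le.
by apply: le_trans (ln_le _) _; lra.
Qed.

(** The inequality [ln (1 - 1/(n+2)) <= - 1/(n+2)] compares each new term with an increment of the
    logarithm. *)
Lemma harmonic_sum_le n : (0 < n)%N ->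
  \sum_(t < n) t.+1%:R^-1 <= 1 + ln n%:R :> R.
Proof.
case: n => // n _; elim: n => [|n ih].
  by rewrite big_ord_recr big_ord0 /= ln1 invr1 add0r addr0.
rewrite big_ord_recr /=; apply: (le_trans (lerD ih (lexx _))).
rewrite -addrA lerD2l -lerBrDl.
have n1 : 0 < n.+1%:R :> R by rewrite ltr0n.
have n2 : 0 < n.+2%:R :> R by rewrite ltr0n.
have := @le_ln1Dx R (- n.+2%:R^-1).
rewrite (_ : 1 + _ = n.+1%:R / n.+2%:R); last first.
  rewrite -[n.+2%:R]natr1; field.
  by rewrite gt_eqF//; have := ler0n R n; lra.
rewrite ln_div ?posrE// => h.
have {}h : ln n.+1%:R - ln n.+2%:R <= - n.+2%:R^-1 :> R.
  by apply: h; rewrite ltrN2 invf_lt1// ltr1n.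
by rewrite -lerN2 opprB.
Qed.

(** The four terms pay for the part of exploration proportional to [w], for the accuracy at
    exploitation times, for the terms without a logarithm (absorbed through [ln L >= ln 2]), and for
    the logarithm in the harmonic sum. *)
Definition epoch_constant (kappa M b zeta u0 : R) : R :=
  M * (kappa * (b / (zeta * u0) ^+ 2 + 4 * b)) + 1 +
  (4 * M) / ln 2 `^ (3^-1) + 2 * M.

Lemma epoch_constant_ge0 (kappa M b zeta u0 : R) :
  0 <= kappa -> 0 <= M -> 0 <= b -> 0 <= epoch_constant kappa M b zeta u0.
Proof.
move=> k0 M0 b0; rewrite /epoch_constant.
by rewrite !addr_ge0 ?mulr_ge0 ?addr_ge0 ?mulr_ge0 ?invr_ge0 ?powR_ge0 ?sqr_ge0.
Qed.

(** With [c = (ln L / L)^(1/3)], the exploration part [ln L / c^2] and the accuracy part [L c] are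
    both equal to [L^(2/3) (ln L)^(1/3)]: this balance is the reason for the choice of [c]. The
    remaining terms are no larger, up to constants. *)
Lemma epoch_cost_le (kappa M b zeta u0 w : R) (d L : nat) :
  0 <= kappa -> 0 <= M -> 0 < b -> 0 < zeta -> 0 < u0 ->
  (0 < d)%N -> (1 < L)%N ->
  w <= kappa * exploration_threshold d zeta u0 b L ->
  M * (1 + d%:R * (d%:R ^+ 2 * w * ln L%:R + 1)) + L%:R * accuracy R L +
    2 * M * d%:R * (1 + ln L%:R) <=
  epoch_constant kappa M b zeta u0 * (d%:R ^+ 3 * rate L%:R).
Proof.
move=> k0 M0 b0 zeta0 u00 d0 L1.
have L0 : 0 < L%:R :> R by rewrite ltr0n ltnW.
have lnL0 : 0 < ln L%:R :> R by rewrite ln_gt0// ltr1n.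
have ln20 : 0 < ln 2 :> R by rewrite ln_gt0// ltr1n.
rewrite /rate /accuracy /exploration_threshold /accuracy powR23; last exact: ltW.
rewrite /epoch_constant.
have xK := cbrtK (ltW lnL0); have yK := cbrtK (ltW L0).
have x0 : 0 < ln L%:R `^ (3^-1) :> R by rewrite powR_gt0.
have y0 : 0 < L%:R `^ (3^-1) :> R by rewrite powR_gt0.
have xy : ln L%:R `^ (3^-1) <= L%:R `^ (3^-1) :> R.
  by rewrite ler_cbrt ?ln_le_id// ltW.
have y1 : 1 <= L%:R `^ (3^-1) :> R.
  by have := @ler_cbrt 1 L%:R ler01; rewrite powR1; apply; rewrite ler1n ltnW.
have x2 : ln 2 `^ (3^-1) <= ln L%:R `^ (3^-1) :> R.
  by rewrite ler_cbrt ?(ltW ln20)// ler_ln ?posrE// ler_nat.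
have r0 : 0 < ln 2 `^ (3^-1) :> R by rewrite powR_gt0.
have D1 : 1 <= d%:R :> R by rewrite ler1n.
(* Now c = x / y, L = y^3, ln L = x^3 and the rate is y^2 x. *)
set x := ln L%:R `^ (3^-1) in xK x0 xy x2 *.
set y := L%:R `^ (3^-1) in yK y0 xy y1 *.
set r := ln 2 `^ (3^-1) in x2 r0 *.
move: (d%:R) D1 => D D1; rewrite -xK -yK => w_le.
pose Z := D ^+ 3 * (y ^+ 2 * x).
have D0 : 0 <= D by apply: le_trans D1.
have [x_ge0 y_ge0 r_ge0] : [/\ 0 <= x, 0 <= y & 0 <= r] by rewrite !ltW.
have DD : D <= D ^+ 3 by rewrite ler_eXnr.
have D3 : 1 <= D ^+ 3 by rewrite exprn_ege1.
have D30 : 0 <= D ^+ 3 by rewrite exprn_ge0.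
have x3 : x ^+ 3 <= y ^+ 2 * x by rewrite exprSr ler_wpM2r// lerXn2r.
have yx0 : 0 <= y ^+ 2 * x by rewrite mulr_ge0 ?sqr_ge0.
have yxZ : y ^+ 2 * x <= Z by rewrite ler_peMl.
have DxZ : D * x ^+ 3 <= Z by rewrite ler_pM ?exprn_ge0.
have rZ : D ^+ 3 <= Z / r.
  rewrite ler_pdivlMr// ler_wpM2l// (le_trans x2)//.
  by rewrite ler_peMl// exprn_ege1.
(* The maximum in the threshold is replaced by the sum of its two nonnegative arguments. *)
have w_le' : w <= kappa * (b / (D * zeta * u0) ^+ 2 + 4 * b / (x / y) ^+ 2).
  rewrite (le_trans w_le)// ler_wpM2l// ge_max.
  by rewrite lerDl lerDr !divr_ge0 ?sqr_ge0 ?mulr_ge0// ltW.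
have wZ : D * (D ^+ 2 * w * x ^+ 3) <=
    kappa * (b / (zeta * u0) ^+ 2 + 4 * b) * Z.
  rewrite (_ : D * _ = D ^+ 3 * x ^+ 3 * w); last by ring.
  apply: (le_trans (ler_wpM2l _ w_le')).
    by rewrite mulr_ge0 ?exprn_ge0.
  rewrite [leLHS]mulrCA -[leRHS]mulrA ler_wpM2l// mulrDr [leRHS]mulrDl.
  apply: lerD.
    rewrite [leLHS]mulrC; apply: ler_pM.
    - by rewrite divr_ge0 ?sqr_ge0// ltW.
    - by rewrite mulr_ge0 ?exprn_ge0.
    - rewrite ler_wpM2l ?(ltW b0)// lef_pV2 ?posrE ?exprn_gt0 ?mulr_gt0//;
        last by apply: lt_le_trans D1.
      by rewrite -(mulrA D) (exprMn _ D) ler_peMl ?sqr_ge0// exprn_ege1.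
    - by rewrite ler_wpM2l.
  rewrite le_eqVlt; apply/orP; left; apply/eqP; rewrite /Z; field.
  by rewrite !gt_eqF.
rewrite -/Z {w_le w_le'}.
have -> : y ^+ 3 * (x / y) = y ^+ 2 * x by field; rewrite gt_eqF.
have DZ : 1 + D + 2 * D <= 4 * (Z / r) by lra.
have -> : M * (1 + D * (D ^+ 2 * w * x ^+ 3 + 1)) + y ^+ 2 * x +
    2 * M * D * (1 + x ^+ 3) =
  M * (D * (D ^+ 2 * w * x ^+ 3)) + y ^+ 2 * x + M * (1 + D + 2 * D) +
  2 * M * (D * x ^+ 3) by ring.
have -> : (M * (kappa * (b / (zeta * u0) ^+ 2 + 4 * b)) + 1 + 4 * M / r +
    2 * M) * Z =
  M * (kappa * (b / (zeta * u0) ^+ 2 + 4 * b) * Z) + Z + M * (4 * (Z / r)) +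
  2 * M * Z by ring.
by rewrite !lerD// ler_wpM2l// mulr_ge0.
Qed.

Lemma geometric_sum_le (rho : R) n : 1 < rho ->
  \sum_(j < n) rho ^+ j <= rho ^+ n / (rho - 1).
Proof.
move=> rho1; rewrite ler_pdivlMr ?subr_gt0// mulrC -subrX1.
by rewrite gerBl.
Qed.

End rates.

(** * Sums over epochs *)

Section epochs.
Context {R : realType}.

(** Exploration times are charged [M] each; [c] and the harmonic term are charged at every time,
    explored or not, which keeps the induction uniform. *)
Lemma epoch_sum_le (g : nat -> R) (M c w : R) (d s L : nat) :
  0 <= M -> 0 <= c ->
  (forall t, (t < L)%N -> g (s + t)%N <= M) ->
  (forall t, (t < L)%N -> t.+1 \notin exploration d w t.+1 ->
     g (s + t)%N <= c + 2 * M * d%:R / t.+1%:R) ->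
  \sum_(t < L) g (s + t)%N <=
    M * (size (exploration d w L))%:R + L%:R * c +
    2 * M * d%:R * \sum_(t < L) t.+1%:R^-1.
Proof.
move=> M0 c0; elim: L => [|L ih] gM gc.
  by rewrite !big_ord0 !mulr0 mul0r !addr0.
have {}ih := ih (fun t tL => gM t (ltnW tL)) (fun t tL => gc t (ltnW tL)).
rewrite !big_ord_recr /= size_explorationS natrD.
have div0 : 0 <= 2 * M * d%:R / L.+1%:R by rewrite !mulr_ge0.
suff : g (s + L)%N <= M * (L.+1 \in exploration d w L.+1)%:R + c +
    2 * M * d%:R / L.+1%:R.
  by move=> gL; rewrite (le_trans (lerD ih gL))// le_eqVlt; apply/orP; left;
    apply/eqP; ring.
have [eL|eL] := boolP (_ \in _); last by rewrite mulr0 add0r gc.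
by rewrite mulr1 (le_trans (gM _ (ltnSn L)))// -addrA lerDl addr_ge0.
Qed.

Lemma sum_epoch_start (g : nat -> R) len k :
  \sum_(n < epoch_start len k) g n =
  \sum_(j < k) \sum_(t < len j) g (epoch_start len j + t)%N.
Proof.
elim: k => [|k ih]; first by rewrite /epoch_start !big_ord0.
have -> : epoch_start len k.+1 = (epoch_start len k + len k)%N.
  by rewrite /epoch_start big_ord_recr.
by rewrite big_split_ord [RHS]big_ord_recr -ih.
Qed.

Variables tau q : R.
Hypotheses (tau_gt1 : 1 < tau) (q_gt1 : 1 < q).

Let len := epoch_length tau q.

Let q_ge0 : 0 <= q. Proof. exact: ltW (lt_trans ltr01 q_gt1). Qed.

Let tau_ge0 : 0 <= tau. Proof. exact: ltW (lt_trans ltr01 tau_gt1). Qed.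

(** Rounding up at most doubles a real number that is at least 1. *)
Lemma epoch_length_bounds k :
  tau * q ^+ k <= (len k)%:R <= 2 * tau * q ^+ k.
Proof.
have qk1 : 1 <= q ^+ k by rewrite exprn_ege1// ltW.
have tqk : 1 <= tau * q ^+ k by rewrite mulr_ege1 ?(ltW tau_gt1).
rewrite /len /epoch_length pmulrn gez0_abs; last first.
  by rewrite ceil_ge0 (lt_le_trans _ tqk)//; lra.
rewrite ceil_ge /=; have := ceilB1_lt (tau * q ^+ k); rewrite intrB.
by move: tqk => *; rewrite -mulrA; lra.
Qed.

Lemma epoch_length_gt1 k : (1 < len k)%N.
Proof.
have /andP[+ _] := epoch_length_bounds k.
rewrite -(ltr_nat R); apply: lt_le_trans.
by rewrite (lt_le_trans tau_gt1)// ler_peMr ?exprn_ege1 ?ltW// (lt_trans ltr01).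
Qed.

Lemma exprn_powR (n : nat) (r : R) : (q ^+ n) `^ r = (q `^ r) ^+ n.
Proof.
by rewrite -(powR_mulrn n q_ge0) -(powR_mulrn n (powR_ge0 q r)) -!powRrM mulrC.
Qed.

(** Once epoch [k] has started, the whole of epoch [k - 1], of length at least [q ^+ (k - 1)], fits
    in [T]. *)
Lemma growth_le k T : (0 < T)%N -> (epoch_start len k <= T)%N ->
  q ^+ k <= q * T%:R.
Proof.
move=> T0; case: k => [_|k startT].
  by rewrite expr0 mulr_ege1 ?(ltW q_gt1)// ler1n.
rewrite exprS ler_wpM2l//.
have /andP[len_ge _] := epoch_length_bounds k.
have : q ^+ k <= (len k)%:R.
  by rewrite (le_trans _ len_ge)// ler_peMl ?exprn_ge0 ?(ltW tau_gt1).
move/le_trans; apply; rewrite ler_nat (leq_trans _ startT)//.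
by rewrite /epoch_start big_ord_recr /= leq_addl.
Qed.

(** The factors come from [ln (len j) <= 2 * ln T], from [len j <= 2 * tau * q ^+ j], and from the
    geometric series of ratio [q^(2/3)]. *)
Definition rate_constant : R :=
  2 `^ (3^-1) * ((2 * tau) `^ (2 / 3) *
                 ((q `^ (2 / 3)) ^+ 2 / (q `^ (2 / 3) - 1))).

(** The rates grow geometrically, so the last one dominates. The lower bound on [T] gives
    [len j <= 2 * tau * q * T <= T^2], which controls the logarithms. *)
Lemma sum_rate_le k T : 2 * tau * q <= T%:R -> (epoch_start len k <= T)%N ->
  \sum_(j < k.+1) rate (len j)%:R <= rate_constant * rate T%:R.
Proof.
move=> T_ge startT.
have D1 : 1 < 2 * tau * q by rewrite !mulr_egt1// ltr1n.
have T1 : 1 < T%:R :> R by rewrite (lt_le_trans D1).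
have T0 : (0 < T)%N by rewrite -(ltr0n R) (lt_trans _ T1).
have qk := growth_le T0 startT.
set rho := q `^ (2 / 3).
have rho1 : 1 < rho.
  rewrite /rho; have := @gt0_ltr_powR R (2 / 3) _ 1 q; rewrite powR1.
  by apply; rewrite ?nnegrE ?divr_gt0.
have lnT0 : 0 <= ln T%:R :> R by rewrite ln_ge0// ltW.
have lnlen j : (j < k.+1)%N -> ln (len j)%:R <= 2 * ln T%:R :> R.
  move=> jk; have /andP[_ len_le] := epoch_length_bounds j.
  have qj : q ^+ j <= q ^+ k by rewrite ler_weXn2l// ltW.
  rewrite mulr_natl mulr2n -lnM ?posrE ?ltr0n//.
  rewrite ler_ln ?posrE ?mulr_gt0 ?ltr0n// ?(ltnW (epoch_length_gt1 j))//.
  rewrite (le_trans len_le)// (@le_trans _ _ (2 * tau * (q * T%:R)))//.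
    by rewrite ler_wpM2l ?mulr_ge0// (le_trans qj).
  by rewrite mulrA ler_wpM2r.
have term j : (j < k.+1)%N -> rate (len j)%:R <=
    (2 * tau) `^ (2 / 3) * rho ^+ j * (2 `^ (3^-1) * ln T%:R `^ (3^-1)).
  move=> jk; rewrite /rate; apply: ler_pM; rewrite ?powR_ge0//.
    rewrite /rho -exprn_powR -powRM ?mulr_ge0 ?exprn_ge0//.
    apply: ge0_ler_powR; rewrite ?nnegrE ?mulr_ge0 ?exprn_ge0//.
    by have /andP[] := epoch_length_bounds j.
  rewrite -powRM// ler_cbrt ?lnlen// ln_ge0// ler1n ltnW//.
  exact: epoch_length_gt1.
apply: (le_trans (ler_sum _ (fun (j : 'I_k.+1) _ => term j (ltn_ord j)))).
rewrite -mulr_suml -mulr_sumr.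
have rhok : rho ^+ k.+1 <= rho ^+ 2 * T%:R `^ (2 / 3).
  rewrite exprS expr2 -mulrA ler_wpM2l ?(ltW (lt_trans ltr01 rho1))//.
  rewrite /rho -exprn_powR -powRM//.
  by apply: ge0_ler_powR; rewrite ?nnegrE ?mulr_ge0 ?exprn_ge0.
have geo : \sum_(j < k.+1) rho ^+ j <= rho ^+ 2 / (rho - 1) * T%:R `^ (2 / 3).
  rewrite (le_trans (geometric_sum_le k.+1 rho1))// mulrAC.
  by rewrite ler_wpM2r// invr_ge0; lra.
rewrite /rate_constant -/rho /rate.
set X := T%:R `^ _; set Y := ln T%:R `^ _.
set a := 2 `^ _; set e := (2 * tau) `^ _.
rewrite (_ : a * _ * _ = e * (rho ^+ 2 / (rho - 1) * X) * (a * Y)); last by ring.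
by rewrite ler_wpM2r ?mulr_ge0 ?powR_ge0// ler_wpM2l ?powR_ge0.
Qed.

End epochs.

(** * Assembly of the epoch bounds into the regret bound *)

Lemma exploration_threshold_gt0 (R : realType) (d T : nat) (zeta u0 b : R) :
  (0 < d)%N -> 0 < zeta -> 0 < u0 -> 0 < b ->
  0 < exploration_threshold d zeta u0 b T.
Proof.
move=> d0 zeta0 u00 b0; rewrite lt_max; apply/orP; left.
by rewrite divr_gt0// exprn_gt0// !mulr_gt0// ltr0n.
Qed.

Lemma accuracy_gt0 (R : realType) (T : nat) : (1 < T)%N -> 0 < accuracy R T.
Proof.
by move=> T1; rewrite divr_gt0 ?powR_gt0 ?ln_gt0 ?ltr1n// ltr0n ltnW.
Qed.

(** [K] and [N] are chosen before the dimension, the distribution and the action set, so the bound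
    is uniform in them and the factor [d^3] is explicit. [kappa] keeps [w] comparable to its
    threshold, as a larger [w] lengthens exploration; [w] varies with the epoch because the accuracy
    does. *)
Theorem theorem4 (R : realType)
    (a zeta u0 b : R) (zeta_gt0 : 0 < zeta) (u0_gt0 : 0 < u0)
    (a_range : 0 < a <= (2 * zeta)^-1) (b_gt : 2 / a < b)
    (tau q : R) (tau_gt1 : 1 < tau) (q_gt1 : 1 < q)
    (kappa M : R) :
  exists (K : R) (N : nat),
  forall (d : nat) (d_gt0 : (0 < d)%N)
    (disp : measure_display) (Omega : measurableType disp)
    (P : probability Omega R)
    (C : nat -> {RV P >-> d.-tuple R})
    (C_iid : iid P (fun n : nat => C n.+1))
    (U : set 'rV[R]_d) (U_compact : compact U)
    (U_dim : full_dimensional U)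
    (cost_light : forall x, U x ->
       light_tailed P u0 (fun o => dot (C 1%N o) x))
    (cost_deviation : forall x, U x ->
       deviation_bound P a zeta u0 (fun n o => dot (C n.+1 o) x))
    (xstar : 'rV[R]_d) (xstar_opt : optimal_action P C U xstar)
    (gap_le : forall x, U x -> mean_cost P C x - mean_cost P C xstar <= M)
    (B : 'I_d -> 'rV[R]_d) (B_spanner : barycentric_spanner U B)
    (coef : 'rV[R]_d -> 'I_d -> R)
    (coef_bary : forall x, U x -> bary_coordinates B x (coef x))
    (w : nat -> R)
    (w_range : forall k : nat,
       let thr := exploration_threshold d zeta u0 b (epoch_length tau q k) in
       thr <= w k <= kappa * thr)
    (pi : policy R d) (pi_measurable : measurable_policy pi)
    (pi_epoch : epoch_policy U B coef (epoch_length tau q) w pi)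
    (T : nat) (T_ge : (N <= T)%N),
    (regret P C xstar pi T <=
       (K * (d%:R ^+ 3 * T%:R `^ (2 / 3) * ln T%:R `^ (3^-1)))%:E)%E.
Proof.
have a0 : 0 < a by case/andP: a_range.
have b0 : 0 < b by rewrite (lt_trans _ b_gt)// divr_gt0.
exists (epoch_constant kappa M b zeta u0 * rate_constant tau q).
(* From this horizon on, [2 * tau * q <= T], as [sum_rate_le] asks. *)
exists `|Num.ceil (2 * tau * q)|%N.
move=> d d_gt0 disp Omega P C C_iid U U_compact U_dim cost_light cost_deviation
  xstar xstar_opt gap_le B B_spanner coef coef_bary w w_range pi mpi pi_epoch
  T T_ge.
set len := epoch_length tau q in w_range pi_epoch.
pose gap x := mean_cost P C x - mean_cost P C xstar.
have [xstarU xstar_min] := xstar_opt.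
have M0 : 0 <= M by rewrite (le_trans _ (gap_le _ xstarU))// subrr.
have thr_gt0 k : 0 < exploration_threshold d zeta u0 b (len k).
  exact: exploration_threshold_gt0.
have len_gt1 k : (1 < len k)%N by exact: epoch_length_gt1.
(* A positive threshold at most [kappa] times itself forces the sign. *)
have kappa0 : 0 <= kappa.
  have /andP[w_ge w_le] := w_range 0%N.
  by rewrite -(pmulr_lge0 _ (thr_gt0 0%N)) (le_trans _ w_le)// (le_trans _ w_ge)// ltW.
have w_gt0 k : 0 < w k.
  by have /andP[w_ge _] := w_range k; rewrite (lt_le_trans (thr_gt0 k)).
have histU n o : U (pi (hist C pi n o)).
  have [k [t [tk nE]]] := epoch_decomposition n (fun k => ltnW (len_gt1 k)).
  by apply: (epoch_action d_gt0 B_spanner.1 pi_epoch tk); rewrite size_tuple.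
have gap_ge0 x : U x -> 0 <= gap x by move=> Ux; rewrite subr_ge0 xstar_min.
pose E n := ('E_P[fun o => gap (pi (hist C pi n o))])%E.
have mgap n : measurable_fun setT (fun o => gap (pi (hist C pi n o))).
  apply: measurable_funB => //.
  exact: (measurable_mean_cost C_iid u0_gt0 U_dim cost_light).
have E_ge0 n : (0 <= E n)%E by apply: expectation_ge0 => o; exact/gap_ge0/histU.
have E_le n : (E n <= M%:E)%E.
  rewrite -[leRHS](expectation_cst P); apply: expectation_le => //.
  - by move=> o; exact/gap_ge0/histU.
  - by apply: aeW => o; exact/gap_le/histU.
pose g n := fine (E n).
have gE n : E n = (g n)%:E.
  by rewrite /g fineK// ge0_fin_numE// (le_lt_trans (E_le n)) ?ltry.
have g_ge0 n : 0 <= g n by rewrite -lee_fin -gE.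
have g_le n : g n <= M by rewrite -lee_fin -gE.
have g_exploit k t : (t < len k)%N -> t.+1 \notin exploration d (w k) t.+1 ->
    g (epoch_start len k + t)%N <=
    accuracy R (len k) + 2 * M * d%:R / t.+1%:R.
  move=> tk tA; rewrite -lee_fin -gE.
  have /andP[w_ge _] := w_range k.
  have [w1 w2] : b / (d%:R * zeta * u0) ^+ 2 <= w k /\
      4 * b / accuracy R (len k) ^+ 2 <= w k.
    by move: w_ge; rewrite /exploration_threshold ge_max => /andP[].
  exact: (exploitation_gap d_gt0 C_iid zeta_gt0 u0_gt0 a0 b_gt U_dim cost_light
    cost_deviation xstar_opt gap_le B_spanner coef_bary mpi pi_epoch
    (accuracy_gt0 _ (len_gt1 k)) tk w1 w2 tA).
have epoch_le k : \sum_(t < len k) g (epoch_start len k + t)%N <=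
    epoch_constant kappa M b zeta u0 * (d%:R ^+ 3 * rate (len k)%:R).
  have /andP[_ w_le] := w_range k.
  apply: le_trans (epoch_cost_le kappa0 M0 b0 zeta_gt0 u0_gt0 d_gt0
    (len_gt1 k) w_le).
  apply: le_trans (epoch_sum_le M0 (ltW (accuracy_gt0 _ (len_gt1 k)))
    (fun t _ => g_le _) (@g_exploit k)) _.
  apply: lerD; last by rewrite ler_wpM2l ?mulr_ge0// harmonic_sum_le// ltnW.
  rewrite lerD2r ler_wpM2l// size_exploration_le//; first exact: ltW.
  exact: ltnW.
have [k [t [tk TE]]] := epoch_decomposition T (fun k => ltnW (len_gt1 k)).
have T_le : (T <= epoch_start len k.+1)%N.
  by rewrite TE /epoch_start big_ord_recr /= leq_add2l ltnW.
have T_geR : 2 * tau * q <= T%:R.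
  rewrite (le_trans (ceil_ge _))// (le_trans (ler_norm _))//.
  by rewrite -intr_norm -abszE -pmulrn ler_nat.
rewrite (regret_gap C_iid u0_gt0 U_compact U_dim cost_light mpi histU xstar_opt).
rewrite (eq_bigr (fun n : 'I_T => (g n)%:E)); last by move=> n _; rewrite -gE.
rewrite sumEFin lee_fin.
(* [T] may fall inside epoch [k]; completing that epoch only adds nonnegative expected gaps. *)
apply: (@le_trans _ _ (\sum_(n < epoch_start len k.+1) g n)).
  rewrite -(subnKC T_le) big_split_ord /= lerDl.
  by apply: sumr_ge0.
rewrite sum_epoch_start.
apply: (le_trans (ler_sum _ (fun (j : 'I_k.+1) _ => epoch_le j))).
rewrite -!mulr_sumr.
have startT : (epoch_start len k <= T)%N by rewrite TE leq_addr.
have := sum_rate_le tau_gt1 q_gt1 T_geR startT.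
rewrite -/len => rate_le.
rewrite -[leRHS]mulrA ler_wpM2l ?epoch_constant_ge0 ?(ltW b0)//.
rewrite -[X in _ <= _ * X]mulrA -/(rate _) mulrCA ler_wpM2l ?exprn_ge0//.
Qed.
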